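(* Let $n\ge 3$. There is a constant $\alpha_0=\alpha_0(n)$, depending only on $n$, with the following property. Let $\omega$ be a fast majorant and let $\phi:\mathbb{S}^{n-1}\to\mathbb{R}^n$ satisfy $|\phi(\xi)-\phi(\eta)|\le\omega(|\xi-\eta|)$ for all $\xi,\eta\in\mathbb{S}^{n-1}$. Let $C=C(\mathbb{B}^n,\omega)>0$ be a constant such that each pair of points $x,y\in\mathbb{B}^n$ can be joined by a rectifiable curve $\gamma\subset\mathbb{B}^n$ satisfying $$\int_\gamma\frac{\omega(1-|\eta|)}{1-|\eta|}\,ds(\eta)\le C\,\omega(|x-y|),$$ where $ds$ is the length measure on $\gamma$. Then, with $\Phi=P_h[\phi]$, for all $x,y\in\mathbb{B}^n$, $$|\Phi(x)-\Phi(y)|\le C\,\alpha_0\,\omega(|x-y|).$$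
   Context: $\mathbb{B}^n$ is the open unit ball of $\mathbb{R}^n$ and $\mathbb{S}^{n-1}$ its boundary; $\sigma$ is the surface measure on $\mathbb{S}^{n-1}$ normalized by $\sigma(\mathbb{S}^{n-1})=1$. The Poisson integral is $P_h[\phi](x)=\int_{\mathbb{S}^{n-1}}P_h(x,\xi)\phi(\xi)\,d\sigma(\xi)$, $x\in\mathbb{B}^n$, with $P_h(x,\xi)=\left(\frac{1-|x|^2}{|\xi-x|^2}\right)^{n-1}$. A majorant is a continuous increasing function $\omega:[0,\infty)\to[0,\infty)$ with $\omega(0)=0$ such that $\omega(t)/t$ is non-increasing for $t>0$. A majorant $\omega$ is fast if there are $\rho_0>0$ and a constant $C'>0$ such that $\int_0^\rho\frac{\omega(t)}{t}\,dt\le C'\omega(\rho)$ for $0<\rho<\rho_0$. It is known that for every fast majorant $\omega$ the ball $\mathbb{B}^n$ is a so-called $\Lambda_\omega$-extension domain, which means that a constant $C=C(\mathbb{B}^n,\omega)$ as in the claim exists (note that $1-|\eta|$ is the distance from $\eta\in\mathbb{B}^n$ to $\partial\mathbb{B}^n$). *)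

(* Defs.v *)
From HB Require Import structures.
From mathcomp Require Import all_boot all_order all_algebra.
From mathcomp Require Import all_classical all_reals all_analysis.

Set Implicit Arguments.
Unset Strict Implicit.
Unset Printing Implicit Defensive.
Import Order.TTheory GRing.Theory Num.Theory.
Import numFieldNormedType.Exports.

Local Open Scope classical_set_scope.
Local Open Scope ring_scope.

(* The library norm on 'rV[R]_n is the sup norm: it induces the same topology,
   but all distances below have to be Euclidean. *)
Definition enorm (R : realType) (n : nat) (x : 'rV[R]_n) : R :=
  Num.sqrt (\sum_(i < n) x 0 i ^+ 2).

Definition unit_ball (R : realType) (n : nat) : set 'rV[R]_n :=
  [set x | enorm x < 1].

Definition unit_sphere (R : realType) (n : nat) : set 'rV[R]_n :=
  [set x | enorm x = 1].

Arguments unit_ball : clear implicits.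
Arguments unit_sphere : clear implicits.

Section hausdorff_measure.
Local Open Scope ereal_scope.
Context (R : realType) (n : nat).
Implicit Types (A U : set 'rV[R]_n) (F : (set 'rV[R]_n)^nat).

(* ediam set0 = -oo, hence the separate case in ediam_pow. *)
Definition ediam U : \bar R :=
  ereal_sup [set (enorm (z.1 - z.2)%R)%:E | z in U `*` U].

Definition ediam_pow (m : nat) U : \bar R :=
  if U == set0 then 0 else ediam U ^+ m.

Definition hausdorff_cover (delta : R) A : set (set 'rV[R]_n)^nat :=
  [set F | A `<=` \bigcup_k F k /\ forall k, ediam (F k) <= delta%:E].

Definition hausdorff_content (m : nat) (delta : R) A : \bar R :=
  ereal_inf [set \sum_(k <oo) ediam_pow m (F k) | F in hausdorff_cover delta A].

(* The m-dimensional Hausdorff outer measure, up to the usual dimensional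
   constant, which disappears in the normalization of sphere_measure. *)
Definition hausdorff (m : nat) A : \bar R :=
  ereal_sup [set hausdorff_content m delta A | delta in [set d : R | (0 < d)%R]].

Lemma ediam_pow_ge0 m U : 0 <= ediam_pow m U.
Proof.
rewrite /ediam_pow; case: eqP => [//|/eqP/set0P[x Ux]].
apply: expe_ge0; apply: (@le_trans _ _ (enorm (x - x)%R)%:E).
  by rewrite lee_fin sqrtr_ge0.
by apply: ereal_sup_ubound; exists (x, x).
Qed.

Lemma ediam_pow0 m : ediam_pow m set0 = 0.
Proof. by rewrite /ediam_pow eqxx. Qed.

Lemma hausdorff_content_ge0 m delta A : 0 <= hausdorff_content m delta A.
Proof.
apply: le_ereal_inf_tmp => _ [F _ <-].
by apply: nneseries_ge0 => k _ _; exact: ediam_pow_ge0.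
Qed.

Lemma hausdorff_content0 m delta : hausdorff_content m delta set0 = 0.
Proof.
apply/eqP; rewrite eq_le hausdorff_content_ge0 andbT.
apply: ereal_inf_lbound; exists (fun=> set0).
  split=> // k; rewrite /ediam setX0 image_set0 ereal_sup0.
  exact: leNye.
by rewrite eseries0// => k _ _; rewrite ediam_pow0.
Qed.

Lemma le_hausdorff_content m delta A B : A `<=` B ->
  hausdorff_content m delta A <= hausdorff_content m delta B.
Proof.
move=> AB; apply/ereal_inf_le_tmp => _ [F [BF dF] <-].
by exists F => //; split => //; exact: subset_trans BF.
Qed.

Lemma hausdorff_content_sigma_subadditive m delta :
  sigma_subadditive (hausdorff_content m delta).
Proof.
move=> A; have [[i ioo]|] :=
    pselect (exists i, hausdorff_content m delta (A i) = +oo).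
  rewrite (eseries_pinfty _ _ ioo) ?leey// => k _.
  by rewrite -ltNye (lt_le_trans _ (hausdorff_content_ge0 _ _ _)).
rewrite -forallNE => Aoo.
suff add2e (e : {posnum R}) :
    hausdorff_content m delta (\bigcup_k A k) <=
    \sum_(i <oo) hausdorff_content m delta (A i) + e%:num%:E.
  by apply/lee_addgt0Pr => _/posnumP[].
rewrite (le_trans _ (epsilon_trick _ _ _))//; last first.
  by move=> k; exact: hausdorff_content_ge0.
pose P k (B : (set 'rV[R]_n)^nat) := hausdorff_cover delta (A k) B /\
  \sum_(j <oo) ediam_pow m (B j) <=
  hausdorff_content m delta (A k) + (e%:num / (2 ^ k.+1)%:R)%:E.
have [G PG] : {G : ((set 'rV[R]_n)^nat)^nat & forall k, P k (G k)}.
  apply: (@choice _ _ P) => k; rewrite /P /hausdorff_content.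
  set S := (X in ereal_inf X); move infS : (ereal_inf S) => iS.
  case: iS infS => [r Sr|Soo|Soo].
  - have en1 : (0 < e%:num / (2 ^ k.+1)%:R)%R by [].
    have /(lb_ereal_inf_adherent en1) : ereal_inf S \is a fin_num by rewrite Sr.
    move=> [x [B cB muBx] xS].
    by exists B; split => //; rewrite muBx -Sr; exact/ltW.
  - by have := Aoo k; rewrite /hausdorff_content Soo.
  - suff : lbound S 0 by move/le_ereal_inf_tmp; rewrite Soo.
    move=> /= _ [B cB <-]; apply: nneseries_ge0 => j _ _.
    exact: ediam_pow_ge0.
have muG_ge0 x : 0 <= (ediam_pow m \o uncurry G) x by exact: ediam_pow_ge0.
apply: (@le_trans _ _ (\esum_(i in setT) (ediam_pow m \o uncurry G) i)).
  apply: ereal_inf_lbound => /=.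
  have /card_esym/ppcard_eqP[f] := card_nat2.
  exists (uncurry G \o f).
    split => [|i]; last first.
      by rewrite /=; case: (f i) => k j /=; exact: (PG k).1.2.
    apply: (@subset_trans _  (\bigcup_k \bigcup_j G k j)) => [t [i _]|].
      by move=> /(PG i).1.1 [j _ ?]; exists i => //; exists j.
    move=> t [i _ [j _ Bijt]]; exists (f^-1%FUN (i, j)) => //=.
    by rewrite invK ?inE.
  rewrite -(esum_pred_image (ediam_pow m \o uncurry G) _ xpredT)
    ?[fun=> _]set_true ?image_eq//.
rewrite (_ : esum _ _ =
    \sum_(i <oo) \sum_(j <oo ) ediam_pow m (G i j)); last first.
  pose J : nat -> set (nat * nat) := fun i => [set (i, j) | j in setT].
  rewrite (_ : setT = \bigcup_k J k); last first.
    by rewrite predeqE => -[a b]; split => // _; exists a => //; exists b.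
  rewrite esum_bigcupT /=; last 2 first.
    - apply/trivIsetP => i j _ _ ij.
      rewrite predeqE => -[k l] /=; split => //= -[] [_] _ [<-{k} _].
      by move=> [m' _] [] /esym/eqP; rewrite (negbTE ij).
    - by move=> /= [k l]; exact: ediam_pow_ge0.
  rewrite -(image_id [set: nat]) -fun_true esum_pred_image//; last first.
    by move=> k _; apply: esum_ge0 => ? _; exact: muG_ge0.
  apply: eq_eseriesr => /= j _.
  rewrite -(esum_pred_image (ediam_pow m \o uncurry G) (pair j) predT)//=.
  - by congr esum; rewrite predeqE => -[a b]; split; move=> [i _ <-]; exists i.
  - by move=> ? _; exact: ediam_pow_ge0.
  - by move=> ? ? _ _; exact: (@can_inj _ _ _ snd).
apply: lee_lim.
- apply: is_cvg_nneseries => k *.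
  by apply: nneseries_ge0 => l *; exact: (muG_ge0 (k, l)).
- apply: is_cvg_nneseries => k *; apply: adde_ge0 => //.
  exact: hausdorff_content_ge0.
- by near=> k; apply: lee_sum => i _; exact: (PG i).2.
Unshelve. all: by end_near. Qed.

Lemma hausdorff0 m : hausdorff m set0 = 0.
Proof.
rewrite /hausdorff; apply/eqP; rewrite eq_le; apply/andP; split.
  by apply: ge_ereal_sup => _ [d _ <-]; rewrite hausdorff_content0.
by apply: ereal_sup_ubound; exists 1%R; rewrite ?hausdorff_content0//=.
Qed.

Lemma hausdorff_ge0 m A : 0 <= hausdorff m A.
Proof.
apply: (le_trans (hausdorff_content_ge0 m 1 A)).
by apply: ereal_sup_ubound; exists 1%R => //=.
Qed.

Lemma le_hausdorff m : {homo hausdorff m : A B / A `<=` B >-> A <= B}.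
Proof.
move=> A B AB; apply: ge_ereal_sup => _ [d d0 <-].
apply: (le_trans (le_hausdorff_content m d AB)).
by apply: ereal_sup_ubound; exists d.
Qed.

Lemma hausdorff_sigma_subadditive m : sigma_subadditive (hausdorff m).
Proof.
move=> F; apply: ge_ereal_sup => _ [d d0 <-].
apply: (le_trans (hausdorff_content_sigma_subadditive m d F)).
apply: lee_nneseries => [k _ _|k _]; first exact: hausdorff_content_ge0.
by apply: ereal_sup_ubound; exists d.
Qed.

HB.instance Definition _ (m : nat) :=
  isOuterMeasure.Build R 'rV[R]_n (hausdorff m) (hausdorff0 m)
    (hausdorff_ge0 m) (@le_hausdorff m) (@hausdorff_sigma_subadditive m).

End hausdorff_measure.

Definition surface_outer_measure (R : realType) (n : nat) :
  {outer_measure set 'rV[R]_n -> \bar R} := @hausdorff R n n.-1.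

Lemma surface_scale_ge0 (R : realType) (n : nat) :
  0 <= (fine (surface_outer_measure R n (unit_sphere R n)))^-1.
Proof. by rewrite invr_ge0 fine_ge0// outer_measure_ge0. Qed.

(* The scaling gives mass 1 to the sphere, over which alone this measure is
   integrated. Its sigma-algebra, that of the Caratheodory-measurable sets,
   contains the Borel sets. *)
Definition sphere_measure (R : realType) (n : nat) :
    {measure set (caratheodory_type (surface_outer_measure R n)) -> \bar R} :=
  mscale (NngNum (surface_scale_ge0 R n))
    (surface_outer_measure R n :
       set (caratheodory_type (surface_outer_measure R n)) -> \bar R).

Definition poisson_kernel (R : realType) (n : nat) (x xi : 'rV[R]_n) : R :=
  ((1 - enorm x ^+ 2) / enorm (xi - x) ^+ 2) ^+ n.-1.

Definition poisson_integral (R : realType) (n : nat)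
    (phi : 'rV[R]_n -> 'rV[R]_n) (x : 'rV[R]_n) : 'rV[R]_n :=
  \row_(i < n) \int[sphere_measure R n]_(xi in unit_sphere R n)
    (poisson_kernel x xi * phi xi 0 i).

(* Functions on [0, +oo[ are represented by functions on R whose values on
   negative numbers are irrelevant. *)
Definition majorant (R : realType) (omega : R -> R) : Prop :=
  [/\ {within `[0, +oo[, continuous omega},
      forall t : R, 0 <= t -> 0 <= omega t,
      forall s t : R, 0 <= s -> s <= t -> omega s <= omega t,
      omega 0 = 0 &
      forall s t : R, 0 < s -> s <= t -> omega t / t <= omega s / s].

Definition fast_majorant (R : realType) (omega : R -> R) : Prop :=
  majorant omega /\
  exists rho0 C' : R, [/\ 0 < rho0, 0 < C' &
    forall rho : R, 0 < rho -> rho < rho0 ->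
      (\int[lebesgue_measure]_(t in `]0%R, rho[) (omega t / t)%R%:E
         <= (C' * omega rho)%R%:E)%E].

Section curves.
Context (R : realType) (n : nat).
Implicit Types (gamma : R -> 'rV[R]_n) (a b : R).

Definition curve_variation a b gamma (s : seq R) : R :=
  let F := gamma \o nth b (a :: s) in
  \sum_(0 <= k < size s) enorm (F k.+1 - F k).

Definition curve_length a b gamma : \bar R :=
  ereal_sup [set (curve_variation a b gamma s)%:E | s in itv_partition a b].

(* Curves are parametrized by [0, 1]. *)
Definition rectifiable_curve gamma : Prop :=
  {within `[0, 1], continuous gamma} /\ (curve_length 0%R 1%R gamma < +oo)%E.

(* The first parameter at which the curve has travelled a distance u. *)
Definition arclength_time gamma (u : R) : R :=
  inf [set t : R | 0 <= t <= 1 /\ (u%:E <= curve_length 0%R t gamma)%E].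

(* Integral with respect to length: the Lebesgue integral along the arc length
   parametrization of gamma. *)
Definition line_integral gamma (f : 'rV[R]_n -> R) : \bar R :=
  (\int[lebesgue_measure]_(u in `[0%R, fine (curve_length 0%R 1%R gamma)])
     (f (gamma (arclength_time gamma u)))%:E)%E.

End curves.

(* 1 - enorm eta is the distance from eta to the boundary of the unit ball. *)
Definition ball_extension_constant (R : realType) (n : nat) (omega : R -> R)
    (C : R) : Prop :=
  forall x y, unit_ball R n x -> unit_ball R n y ->
    exists gamma : R -> 'rV[R]_n,
      [/\ rectifiable_curve gamma, gamma 0 = x, gamma 1 = y,
          forall t : R, 0 <= t <= 1 -> unit_ball R n (gamma t) &
          (line_integral gamma
             (fun eta => omega (1 - enorm eta) / (1 - enorm eta))%R
           <= (C * omega (enorm (x - y)))%R%:E)%E].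
Arguments ball_extension_constant : clear implicits.

(* Main.v *)
Require Import Defs.
From mathcomp Require Import all_boot all_order all_algebra.
From mathcomp Require Import all_classical all_reals all_analysis.
From mathcomp Require Import measurable_realfun ring lra.
Import Order.TTheory GRing.Theory Num.Theory.
Import numFieldNormedType.Exports.
Local Open Scope classical_set_scope.
Local Open Scope ring_scope.

(** The claim is a gradient bound for Phi, used in finite-difference form and
    summed along the curve.  Write m = n - 1 and D = 1 - |x|^2.

    Local bound.  If x is in the ball and |x - y| <= (1 - |x|) / 4, then
    |Phi x - Phi y| <= alpha (omega (1 - |x|) / (1 - |x|)) |x - y| with alpha
    depending on n only ([poisson_integral_local_le]).  Cutting the arc-length
    parametrization of the curve into short steps and adding up these bounds
    gives |Phi x - Phi y| <= (5/4) alpha times the integral of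
    omega (1 - |.|) / (1 - |.|) along the curve ([increment_le_line_integral]),
    which is at most C omega (|x - y|) for the curve supplied by the extension
    constant.

    Proof of the local bound.  Let zeta be the radial projection of x on the
    sphere.  Both P_h(x, .) and P_h(y, .) have mean 1 over the sphere, so phi
    may be replaced by phi - phi zeta.  Pointwise,
    |P_h(x, xi) - P_h(y, xi)| is at most c |x - y| / (1 - |x|) times P_h(x, xi),
    and, omega (t) / t being non-increasing,
    omega (|xi - zeta|) <= (1 + 2 |xi - x| / (1 - |x|)) omega (1 - |x|).  What
    remains is that P_h(x, .) has mean 1 ([mean_poisson_kernel]) and that
    P_h(x, xi) |xi - x| has mean at most c (1 - |x|) ([mean_poisson_dist_le]).

    Both means come from one change of variables.  Let T xi be the second
    intersection with the sphere of the line through xi and x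
    ([chord_flip]).  It satisfies |T xi - x| = D / |xi - x| and
    |T xi - T eta| = D |xi - eta| / (|xi - x| |eta - x|), so near xi it dilates
    lengths by D / |xi - x|^2 and m-dimensional Hausdorff measure by the m-th
    power of that, which is P_h(x, xi).  Therefore the mean of
    P_h(x, xi) |xi - x|^p is at most that of (D / |xi - x|)^p
    ([poisson_change_of_variables]).  The exponents p = 0 and p = 2m give the
    two inequalities of [mean_poisson_kernel].  The exponent p = 1 reduces
    [mean_poisson_dist_le] to a uniform bound for the mean of 1 / |xi - x|.
    Up to a constant, 1 / |xi - x| is at most the sum over dyadic t of
    t^(m-1) P_h((1 - t) zeta, xi), whose mean is the sum of the t^(m-1); this is
    bounded because m >= 2.

    The sphere carries a normalized Hausdorff measure, for which continuous
    functions are measurable because Hausdorff outer measure is additive on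
    sets at positive distance ([hausdorff_caratheodory]).  If the sphere had
    Hausdorff measure 0 or infinity, the normalizing factor would be 0 and Phi
    would vanish ([poisson_integral_degenerate]); otherwise the total mass
    is 1. *)

Set Implicit Arguments.
Unset Strict Implicit.
Unset Printing Implicit Defensive.

(** * Euclidean inner product and norm *)

Section euclidean_norm.
Context {R : realType} {n : nat}.
Implicit Types (x y z : 'rV[R]_n).

Definition dot x y : R := \sum_(i < n) x 0 i * y 0 i.

Lemma dotC x y : dot x y = dot y x.
Proof. by apply: eq_bigr => i _; rewrite mulrC. Qed.

Lemma dotDl x y z : dot (x + y) z = dot x z + dot y z.
Proof. by rewrite -big_split; apply: eq_bigr => i _; rewrite mxE mulrDl. Qed.

Lemma dotDr x y z : dot z (x + y) = dot z x + dot z y.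
Proof. by rewrite dotC dotDl !(dotC z). Qed.

Lemma dotZl a x z : dot (a *: x) z = a * dot x z.
Proof. by rewrite mulr_sumr; apply: eq_bigr => i _; rewrite mxE mulrA. Qed.

Lemma dotZr a x z : dot z (a *: x) = a * dot z x.
Proof. by rewrite dotC dotZl (dotC z). Qed.

Lemma dotNl x z : dot (- x) z = - dot x z.
Proof. by rewrite -scaleN1r dotZl mulN1r. Qed.

Lemma dotNr x z : dot z (- x) = - dot z x.
Proof. by rewrite dotC dotNl dotC. Qed.

Lemma dotxx_ge0 x : 0 <= dot x x.
Proof. by apply: sumr_ge0 => i _; rewrite -expr2 sqr_ge0. Qed.

Lemma enorm_ge0 x : 0 <= enorm x.
Proof. exact: sqrtr_ge0. Qed.

Lemma sqr_enorm x : enorm x ^+ 2 = dot x x.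
Proof.
rewrite /enorm (eq_bigr (fun i => x 0 i * x 0 i)); last by move=> i _; rewrite expr2.
by rewrite sqr_sqrtr// dotxx_ge0.
Qed.

Lemma le_of_sqr_le (a b : R) : 0 <= b -> (a ^+ 2 <= b ^+ 2) -> a <= b.
Proof.
move=> b0 ab; rewrite (le_trans (ler_norm a))// -(ler_pXn2r (n := 2))// ?nnegrE//.
by rewrite real_normK// num_real.
Qed.

Lemma le_coord_enorm x i : `|x 0 i| <= enorm x.
Proof.
apply: le_of_sqr_le; first exact: enorm_ge0.
rewrite sqr_enorm real_normK ?num_real// /dot (bigD1 i)//= expr2 lerDl.
by apply: sumr_ge0 => j _; rewrite -expr2 sqr_ge0.
Qed.

Lemma enorm0_eq0 x : enorm x = 0 -> x = 0.
Proof.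
move=> x0; apply/rowP => i; rewrite mxE; apply/eqP; rewrite -normr_le0 -x0.
exact: le_coord_enorm.
Qed.

Lemma enorm0 : enorm (0 : 'rV[R]_n) = 0.
Proof.
by apply/eqP; rewrite -sqrf_eq0 sqr_enorm /dot big1// => i _; rewrite mxE mul0r.
Qed.

Lemma enorm_gt0 x : x != 0 -> 0 < enorm x.
Proof.
by move=> x0; rewrite lt_neqAle enorm_ge0 andbT eq_sym; apply: contra_neq x0 => /enorm0_eq0.
Qed.

Lemma enormZ a x : enorm (a *: x) = `|a| * enorm x.
Proof.
apply/eqP; rewrite -(eqrXn2 (n := 2))// ?mulr_ge0 ?enorm_ge0//.
by rewrite exprMn !sqr_enorm dotZl dotZr mulrA -expr2 real_normK ?num_real.
Qed.

Lemma enormN x : enorm (- x) = enorm x.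
Proof. by rewrite -scaleN1r enormZ normrN1 mul1r. Qed.

Lemma enormC x y : enorm (x - y) = enorm (y - x).
Proof. by rewrite -enormN opprB. Qed.

Lemma dot_le x y : dot x y <= enorm x * enorm y.
Proof.
apply: le_of_sqr_le; first by rewrite mulr_ge0 ?enorm_ge0.
have [->|y0] := eqVneq y 0.
  by rewrite enorm0 mulr0 /dot big1// => i _; rewrite mxE mulr0.
have B0 : 0 < dot y y by rewrite -sqr_enorm exprn_gt0// enorm_gt0.
rewrite exprMn !sqr_enorm.
have := dotxx_ge0 (dot y y *: x - dot x y *: y).
rewrite !(dotDl, dotDr, dotNl, dotNr, dotZl, dotZr) (dotC y x).
set A := dot x x; set B := dot y y in B0 *; set c := dot x y.
rewrite (_ : _ + _ = B * (A * B - c ^+ 2)); last by ring.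
by rewrite pmulr_rge0// subr_ge0.
Qed.

Lemma enormD x y : enorm (x + y) <= enorm x + enorm y.
Proof.
apply: le_of_sqr_le; first by rewrite addr_ge0 ?enorm_ge0.
rewrite sqr_enorm !(dotDl, dotDr) (dotC y x) -!sqr_enorm.
by have := dot_le x y; nra.
Qed.

Lemma enorm_dist_triangle x y z : enorm (x - z) <= enorm (x - y) + enorm (y - z).
Proof. by apply: le_trans (enormD _ _); rewrite addrA subrK. Qed.

Lemma enorm_distl x y : `|enorm x - enorm y| <= enorm (x - y).
Proof.
rewrite ler_norml; apply/andP; split.
  have := enormD (y - x) x; rewrite subrK (enormC y); lra.
have := enormD (x - y) y; rewrite subrK; lra.
Qed.

Lemma enorm_le_sum x : enorm x <= \sum_(i < n) `|x 0 i|.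
Proof.
have s0 : 0 <= \sum_(i < n) `|x 0 i| by apply: sumr_ge0.
apply: le_of_sqr_le => //; rewrite sqr_enorm expr2 mulr_suml; apply: ler_sum => i _.
rewrite -expr2 -[leLHS]real_normK ?num_real// expr2 ler_wpM2l//.
by rewrite (bigD1 i)//= lerDl sumr_ge0.
Qed.

Lemma enorm_le_bound x a : (forall i, `|x 0 i| <= a) -> enorm x <= n%:R * a.
Proof.
move=> xa; apply: (le_trans (enorm_le_sum x)).
apply: (le_trans (ler_sum _ (fun i _ => xa i))).
by rewrite sumr_const card_ord mulr_natl.
Qed.

End euclidean_norm.

(** * Hausdorff measure is a metric outer measure *)

Section hausdorff_metric.
Context {R : realType} {n : nat}.
Implicit Types (A B E U V X : set 'rV[R]_n).

Lemma le_ediam U V : U `<=` V -> (ediam U <= ediam V)%E.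
Proof.
move=> UV; apply: ge_ereal_sup => _ [[x y] [/= Ux Uy] <-].
by apply: ereal_sup_ubound; exists (x, y) => //; split; exact: UV.
Qed.

Lemma ediam_ge0 U : U !=set0 -> (0 <= ediam U)%E.
Proof.
case=> x Ux; apply: (@le_trans _ _ (enorm (x - x))%:E).
  by rewrite lee_fin enorm_ge0.
by apply: ereal_sup_ubound; exists (x, x).
Qed.

Lemma le_expe (a b : \bar R) m : (0 <= a)%E -> (a <= b)%E -> (a ^+ m <= b ^+ m)%E.
Proof.
move=> a0 ab; elim: m => [|m IH]; first by rewrite !expe0.
by rewrite !expeS lee_pmul// expe_ge0.
Qed.

Lemma expeMl (L : R) (a : \bar R) m : ((L%:E * a) ^+ m = (L ^+ m)%:E * a ^+ m)%E.
Proof.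
elim: m => [|m IH]; first by rewrite !expe0 mul1e.
by rewrite !expeS IH exprS EFinM muleACA.
Qed.

Lemma le_ediam_pow m U V : U `<=` V -> (ediam_pow m U <= ediam_pow m V)%E.
Proof.
move=> UV; rewrite {1}/ediam_pow; case: eqP => [_|/eqP/set0P U0].
  exact: ediam_pow_ge0.
rewrite /ediam_pow ifF; last first.
  by apply/negbTE/set0P; case: U0 => x /UV; exists x.
by apply: le_expe (le_ediam UV); exact: ediam_ge0.
Qed.

Lemma le_hausdorff_content_delta m (d e : R) A : d <= e ->
  (hausdorff_content m e A <= hausdorff_content m d A)%E.
Proof.
move=> de; apply/ereal_inf_le_tmp => _ [F [AF dF] <-]; exists F => //; split=> //.
by move=> k; rewrite (le_trans (dF k))// lee_fin.
Qed.

Lemma hausdorff_content_le m (d : R) A : 0 < d ->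
  (hausdorff_content m d A <= hausdorff m A)%E.
Proof. by move=> d0; apply: ereal_sup_ubound; exists d. Qed.

(** A covering set of diameter less than the gap meets at most one of A and B,
    so a fine cover of the union splits into covers of A and of B. *)
Lemma hausdorff_content_separated m (delta d : R) A B : d < delta ->
  (forall x y, A x -> B y -> delta <= enorm (x - y)) ->
  (hausdorff_content m d A + hausdorff_content m d B
     <= hausdorff_content m d (A `|` B))%E.
Proof.
move=> dlt AB; apply: le_ereal_inf_tmp => _ [F [ABF dF] <-].
pose FA k := F k `&` A; pose FB k := F k `&` B.
apply: (@le_trans _ _ (\sum_(k <oo) (ediam_pow m (FA k))
                       + \sum_(k <oo) (ediam_pow m (FB k)))%E).
  apply: leeD; apply: ereal_inf_lbound.
    exists FA => //; split=> [x Ax|k]; last by apply: le_trans (dF k); apply: le_ediam => ? [].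
    by have [k _ Fkx] := ABF x (or_introl Ax); exists k.
  exists FB => //; split=> [x Ax|k]; last by apply: le_trans (dF k); apply: le_ediam => ? [].
  by have [k _ Fkx] := ABF x (or_intror Ax); exists k.
rewrite -nneseriesD; [|by move=> *; exact: ediam_pow_ge0..].
apply: lee_nneseries => [k _ _|k _]; first by rewrite adde_ge0 ?ediam_pow_ge0.
have [FA0|/eqP/set0P[x [Fx Ax]]] := pselect (FA k = set0).
  rewrite FA0 ediam_pow0 add0e; apply: le_ediam_pow; exact: subIsetl.
suff -> : FB k = set0 by rewrite ediam_pow0 adde0; apply: le_ediam_pow; exact: subIsetl.
apply/eqP; apply: contraT => /set0P[y [Fy By]].
have : ((enorm (x - y))%:E <= ediam (F k))%E by apply: ereal_sup_ubound; exists (x, y).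
move=> /le_trans/(_ (dF k)); rewrite lee_fin => xyd.
by have := AB _ _ Ax By; rewrite leNgt (le_lt_trans xyd).
Qed.

Lemma hausdorff_separated m (delta : R) A B : 0 < delta ->
  (forall x y, A x -> B y -> delta <= enorm (x - y)) ->
  (hausdorff m A + hausdorff m B <= hausdorff m (A `|` B))%E.
Proof.
move=> delta0 AB.
have [->|Xoo] := eqVneq (hausdorff m (A `|` B)) +oo%E; first exact: leey.
have c d e : 0 < d -> 0 < e ->
    (hausdorff_content m d A + hausdorff_content m e B <= hausdorff m (A `|` B))%E.
  move=> d0 e0; set r := Num.min (Num.min d e) (delta / 2).
  have r0 : 0 < r by rewrite !lt_min d0 e0 divr_gt0.
  have [rd re] : r <= d /\ r <= e.
    by split; rewrite !ge_min lexx ?orbT.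
  apply: le_trans (hausdorff_content_le m _ r0).
  apply: le_trans (hausdorff_content_separated m _ AB).
    by apply: leeD; exact: le_hausdorff_content_delta.
  by rewrite !gt_min; apply/orP; right; lra.
have fA d : 0 < d -> hausdorff_content m d A \is a fin_num.
  move=> d0; rewrite ge0_fin_numE ?hausdorff_content_ge0//.
  apply: (@le_lt_trans _ _ (hausdorff m (A `|` B))); last by rewrite ltey.
  apply: le_trans (c _ _ d0 d0); rewrite leeDl ?hausdorff_content_ge0//.
have fB : hausdorff m B \is a fin_num.
  rewrite ge0_fin_numE ?hausdorff_ge0//.
  apply: (@le_lt_trans _ _ (hausdorff m (A `|` B))); last by rewrite ltey.
  by apply: le_hausdorff; right.
rewrite -leeBrDr//; apply: ge_ereal_sup => _ [d /= d0 <-].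
rewrite leeBrDr// -leeBrDl ?fA//; apply: ge_ereal_sup => _ [e /= e0 <-].
by rewrite leeBrDl ?fA// c.
Qed.

(** Caratheodory's criterion.  The hypothesis says that E is closed.  Exhaust
    X minus E by the sets A k of points at distance at least 1/(k+1) from E;
    since E and A k are at positive distance, only the convergence of the
    measure of A k to that of X minus E is at stake.  The layers
    Rg k = A (k+1) minus A k have finite total measure, because two layers that
    are not adjacent are at positive distance, and X minus E differs from A k
    by a tail of these layers. *)
Lemma hausdorff_caratheodory m E :
  (forall x, ~ E x -> exists2 e : R, 0 < e & forall y, E y -> e <= enorm (x - y)) ->
  (@hausdorff R n m).-caratheodory E.
Proof.
move=> Ecl; apply: (@le_caratheodory_measurable _ _ (@hausdorff R n m)) => X.
change (hausdorff m (X `&` E) + hausdorff m (X `&` ~` E) <= hausdorff m X)%E.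
have [->|Xoo] := eqVneq (hausdorff m X) +oo%E; first exact: leey.
have fX : hausdorff m X \is a fin_num.
  by rewrite ge0_fin_numE ?hausdorff_ge0// ltey.
pose A k := [set x | X x /\ forall y, E y -> k.+1%:R^-1 <= enorm (x - y)].
pose Rg k := A k.+1 `\` A k.
have AX k : A k `<=` X by move=> x [].
have incA k : A k `<=` A k.+1.
  move=> x [Xx Ax]; split=> // y /Ax; apply: le_trans.
  by rewrite lef_pV2 ?posrE ?ltr0n// ler_nat.
have step k : (hausdorff m (A k) + hausdorff m (Rg k.+1) <= hausdorff m (A k.+2))%E.
  apply: (@le_trans _ _ (hausdorff m (A k `|` Rg k.+1))); last first.
    by apply: le_hausdorff => x [/incA/incA//|[]].
  apply: (@hausdorff_separated m (k.+1%:R^-1 - k.+2%:R^-1)).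
    by rewrite subr_gt0 ltf_pV2 ?posrE ?ltr0n// ltr_nat.
  move=> x y [Xx Ax] [[Xy _] nAy].
  have [z Ez yz] : exists2 z, E z & enorm (y - z) < k.+2%:R^-1.
    apply/not_exists2P => H; apply: nAy; split=> // z Ez.
    by have [//|/negP] := H z; rewrite -leNgt.
  by rewrite lerBlDr (le_trans (Ax _ Ez))// (le_trans (enorm_dist_triangle x y z))// lerD2l ltW.
(* Rg k.+1 is at positive distance from A k, not from A k.+1: hence the two
   consecutive terms on the right *)
have sumR N : (\sum_(0 <= k < N) hausdorff m (Rg k.+1)
    <= hausdorff m (A N) + hausdorff m (A N.+1))%E.
  elim: N => [|N IH]; first by rewrite big_geq// adde_ge0 ?hausdorff_ge0.
  rewrite big_nat_recr//= addeC; apply: le_trans (leeD2l _ IH) _.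
  rewrite addeA [X in (_ <= X)%E]addeC leeD2r// addeC; exact: step.
have ser_fin : (\sum_(0 <= k <oo) hausdorff m (Rg k.+1) < +oo)%E.
  apply: (@le_lt_trans _ _ (hausdorff m X + hausdorff m X)%E); last first.
    by rewrite ltey_eq fin_numD fX.
  apply: lime_le.
    by apply: is_cvg_nneseries => *; exact: hausdorff_ge0.
  near=> N; apply: (le_trans (sumR N)).
  by apply: leeD; apply: le_hausdorff; exact: AX.
have tail := nneseries_tail_cvg ser_fin (fun k _ => hausdorff_ge0 m (Rg k.+1)).
have cover k : (hausdorff m (X `&` ~` E) <= hausdorff m (A k.+1)
    + \sum_(k <= j <oo) hausdorff m (Rg j.+1))%E.
  rewrite -(nneseries_addn k); last by move=> *; exact: hausdorff_ge0.
  apply: le_trans (leeD2l _ (hausdorff_sigma_subadditive m (fun j => Rg (j + k).+1))).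
  rewrite -/(hausdorff m _).
  apply: (@le_trans _ _ (hausdorff m (A k.+1 `|` \bigcup_j Rg (j + k).+1))); last first.
    exact: (outer_measureU2 (@hausdorff R n m)).
  apply: le_hausdorff => x [Xx nEx]; have [e e0 eE] := Ecl _ nEx.
  have [N Ax] : exists N, A N x.
    exists (Num.bound e^-1); split=> // y /eE; apply: le_trans.
    rewrite invf_ple ?posrE ?ltr0n// (le_trans (ltW (archi_boundP _)))//.
      by rewrite invr_ge0 ltW.
    by rewrite ler_nat.
  have incAD i : A i `<=` A (i + N)%N.
    by elim: N {Ax} => [|N IH]; rewrite ?addn0// addnS => y /IH/incA.
  have {}Ax : A (k.+1 + N)%N x.
    by elim: k.+1 => [//|i IH]; rewrite addSn; exact: incA.
  elim: N {incAD} Ax => [|N IH] Ax; first by left; rewrite addn0 in Ax.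
  have [/IH//|nAx] := pselect (A (k.+1 + N)%N x).
  right; exists N => //; split; first by rewrite addnC -addnS -addSn in Ax *.
  by rewrite addnC.
have XE k : (hausdorff m (X `&` E) + hausdorff m (A k) <= hausdorff m X)%E.
  apply: (@le_trans _ _ (hausdorff m ((X `&` E) `|` A k))); last first.
    by apply: le_hausdorff => x [[]|[]].
  apply: (@hausdorff_separated m k.+1%:R^-1) => // x y [_ Ex] [_ /(_ _ Ex)].
  by rewrite enormC.
have XEtail k : (hausdorff m (X `&` E) + hausdorff m (X `&` ~` E)
    <= hausdorff m X + \sum_(k <= j <oo) hausdorff m (Rg j.+1))%E.
  apply: (le_trans (leeD2l _ (cover k))); rewrite addeA; exact: leeD2r.
rewrite -[X in (_ <= X)%E]adde0.
apply: cvge_ge (cvgeD _ (cvg_cst _) tail); first exact: nearW.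
by rewrite fin_num_adde_defr.
Unshelve. all: by end_near. Qed.

Lemma hausdorff_lipschitz_image m (L : R) (T : 'rV[R]_n -> 'rV[R]_n) A : 0 < L ->
  (forall x y, A x -> A y -> enorm (T x - T y) <= L * enorm (x - y)) ->
  (hausdorff m (T @` A) <= (L ^+ m)%:E * hausdorff m A)%E.
Proof.
move=> L0 TL; apply: ge_ereal_sup => _ [d /= d0 <-].
apply: (@le_trans _ _ ((L ^+ m)%:E * hausdorff_content m (d / L) A)%E); last first.
  apply: lee_wpmul2l; first by rewrite lee_fin exprn_ge0// ltW.
  exact: hausdorff_content_le (divr_gt0 d0 L0).
rewrite -lee_pdivrMl ?exprn_gt0//; apply: le_ereal_inf_tmp => _ [F [AF dF] <-].
rewrite lee_pdivrMl ?exprn_gt0// -nneseriesZl; last first.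
  by move=> *; exact: ediam_pow_ge0.
pose G k := T @` (F k `&` A).
have dG k : (ediam (G k) <= L%:E * ediam (F k))%E.
  apply: ge_ereal_sup => _ [[_ _] [/= [x [Fx Ax] <-] [y [Fy Ay] <-]] <-].
  apply: (@le_trans _ _ (L%:E * (enorm (x - y))%:E)%E); first by rewrite lee_fin TL.
  apply: lee_wpmul2l; first by rewrite lee_fin ltW.
  by apply: ereal_sup_ubound; exists (x, y).
apply: (@le_trans _ _ (\sum_(k <oo) ediam_pow m (G k))%E).
  apply: ereal_inf_lbound; exists G => //; split=> [_ [x Ax <-]|k].
    by have [k _ Fx] := AF _ Ax; exists k => //; exists x.
  apply: (le_trans (dG k)); rewrite -[d](divfK (lt0r_neq0 L0)) mulrC EFinM.
  by apply: lee_wpmul2l; rewrite ?dF// lee_fin ltW.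
apply: lee_nneseries => [k _ _|k _]; first exact: ediam_pow_ge0.
rewrite {1}/ediam_pow; case: eqP => [_|/eqP/set0P G0].
  by rewrite mule_ge0 ?ediam_pow_ge0// lee_fin exprn_ge0// ltW.
have F0 : F k !=set0 by case: G0 => _ [x [Fx _] _]; exists x.
rewrite /ediam_pow ifF; last exact/negbTE/set0P.
apply: le_trans (le_expe m (ediam_ge0 G0) (dG k)) _.
by rewrite expeMl.
Qed.

End hausdorff_metric.

(** * The chord involution of the sphere through an interior point *)

Section sphere_reflection.
Context {R : realType} {n : nat}.
Implicit Types (x y z xi eta : 'rV[R]_n).

(** The second intersection with the unit sphere of the line through xi and x,
    for xi on the sphere and x in the ball. *)
Definition chord_flip x xi : 'rV[R]_n :=
  x - ((1 - enorm x ^+ 2) / enorm (xi - x) ^+ 2) *: (xi - x).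

(** Minus an inversion centred at x, whose power 1 - |x|^2 is the product
    |xi - x| |T xi - x| of the two pieces of a chord through x. *)
Lemma chord_flipB x xi : chord_flip x xi - x =
  - (((1 - enorm x ^+ 2) / enorm (xi - x) ^+ 2) *: (xi - x)).
Proof. by apply/eqP; rewrite subr_eq addrC. Qed.

Lemma ball_defect_gt0 x : unit_ball R n x -> 0 < 1 - enorm x ^+ 2.
Proof. by move=> x1; rewrite subr_gt0 expr_lt1// enorm_ge0. Qed.

Lemma sphere_dist_ge x xi : unit_sphere R n xi -> 1 - enorm x <= enorm (xi - x).
Proof. by move=> <-; have := enorm_distl xi x; rewrite ler_norml; lra. Qed.

Lemma sphere_dist_le x xi : unit_sphere R n xi -> enorm (xi - x) <= 1 + enorm x.
Proof. by move=> <-; have := enormD xi (- x); rewrite enormN. Qed.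

Lemma sphere_dist_gt0 x xi :
  unit_ball R n x -> unit_sphere R n xi -> 0 < enorm (xi - x).
Proof. by move=> x1 /(sphere_dist_ge x); apply: lt_le_trans; rewrite subr_gt0. Qed.

Lemma chord_flip_sphere x xi : unit_ball R n x -> unit_sphere R n xi ->
  unit_sphere R n (chord_flip x xi).
Proof.
move=> x1 sxi; have r0 := sphere_dist_gt0 x1 sxi.
apply/eqP; rewrite /unit_sphere /= -(eqrXn2 (n := 2))// ?enorm_ge0// expr1n.
rewrite sqr_enorm /chord_flip.
have : enorm ((xi - x) + x) ^+ 2 = 1 by rewrite subrK sxi expr1n.
move: (xi - x) r0 => u r0.
move=> E; rewrite sqr_enorm !(dotDl, dotDr) (dotC u x) -!sqr_enorm in E.
have {E}Eu : dot x u = (1 - enorm x ^+ 2 - enorm u ^+ 2) / 2 by lra.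
rewrite !(dotDl, dotDr, dotNl, dotNr, dotZl, dotZr) (dotC u x) -!sqr_enorm Eu.
move: (enorm x) (enorm u) r0 => a b b0; apply/eqP; field.
by rewrite lt0r_neq0.
Qed.

Lemma chord_flip_dist x xi : unit_ball R n x -> unit_sphere R n xi ->
  enorm (chord_flip x xi - x) = (1 - enorm x ^+ 2) / enorm (xi - x).
Proof.
move=> x1 sxi; have r0 := sphere_dist_gt0 x1 sxi.
have D0 := ball_defect_gt0 x1.
rewrite chord_flipB enormN enormZ ger0_norm; last first.
  by rewrite divr_ge0 ?exprn_ge0 ?ltW.
by field; rewrite lt0r_neq0.
Qed.

Lemma chord_flipK x xi : unit_ball R n x -> unit_sphere R n xi ->
  chord_flip x (chord_flip x xi) = xi.
Proof.
move=> x1 sxi; have r0 := sphere_dist_gt0 x1 sxi.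
have D0 := ball_defect_gt0 x1.
rewrite {1}/chord_flip chord_flip_dist// chord_flipB.
rewrite scalerN opprK scalerA -[RHS](subrK x) addrC; congr (_ + _).
rewrite -[RHS]scale1r; congr (_ *: _).
move: (1 - _) D0 (enorm (xi - x)) r0 => D D0 r r0.
by field; rewrite !lt0r_neq0.
Qed.

Lemma chord_flip_conformal x xi eta :
  unit_ball R n x -> unit_sphere R n xi -> unit_sphere R n eta ->
  enorm (chord_flip x xi - chord_flip x eta)
    = (1 - enorm x ^+ 2) / (enorm (xi - x) * enorm (eta - x)) * enorm (xi - eta).
Proof.
move=> x1 sxi seta; have r0 := sphere_dist_gt0 x1 sxi.
have s0 := sphere_dist_gt0 x1 seta; have D0 := ball_defect_gt0 x1.
apply/eqP; rewrite -(eqrXn2 (n := 2))// ?enorm_ge0//; last first.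
  by rewrite mulr_ge0 ?enorm_ge0// divr_ge0// ?mulr_ge0// ltW.
have -> : xi - eta = (xi - x) - (eta - x) by rewrite opprB addrA subrK.
rewrite exprMn /chord_flip.
move: (xi - x) (eta - x) r0 s0 (1 - _) D0 => u v u0 v0 D D0; rewrite !sqr_enorm.
rewrite !(dotDl, dotDr, dotNl, dotNr, dotZl, dotZr) (dotC v u) -!sqr_enorm.
rewrite (dotC u x) (dotC v x); apply/eqP; field.
by rewrite !lt0r_neq0.
Qed.

Lemma chord_flip_image x (a b : R) : unit_ball R n x -> 0 < a ->
  [set xi | unit_sphere R n xi /\ a <= enorm (xi - x) < b]
  `<=` chord_flip x @` [set xi | unit_sphere R n xi /\
          a <= (1 - enorm x ^+ 2) / enorm (xi - x) < b].
Proof.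
move=> x1 a0 xi [sxi abxi]; exists (chord_flip x xi); last exact: chord_flipK.
split; first exact: chord_flip_sphere.
rewrite chord_flip_dist// invf_div mulrCA divff ?mulr1//.
by rewrite lt0r_neq0// ball_defect_gt0.
Qed.

End sphere_reflection.

(** * Means over the sphere *)

Section sphere_integral.
Context {R : realType} {n : nat}.
Implicit Types (x xi eta : 'rV[R]_n) (f g : 'rV[R]_n -> R).

Local Notation V := (caratheodory_type (surface_outer_measure R n)).
Local Notation S := (unit_sphere R n : set V).
Local Notation sigma := (sphere_measure R n).

Lemma measurable_separated (E : set 'rV[R]_n) :
  (forall x, ~ E x -> exists2 e : R, 0 < e & forall y, E y -> e <= enorm (x - y)) ->
  measurable (E : set V).
Proof. exact: hausdorff_caratheodory. Qed.

Lemma measurable_sphere : measurable S.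
Proof.
apply: measurable_separated => x /eqP x1; exists `|enorm x - 1|.
  by rewrite normr_gt0 subr_eq0.
by move=> y <-; exact: enorm_distl.
Qed.

Definition continuous_on_sphere f := forall xi, unit_sphere R n xi ->
  forall e : R, 0 < e -> exists2 d : R, 0 < d & forall eta, unit_sphere R n eta ->
    enorm (xi - eta) < d -> `|f xi - f eta| < e.

(** The superlevel sets of f in the sphere are closed. *)
Lemma continuous_on_sphere_measurable f :
  continuous_on_sphere f -> measurable_fun S (f : V -> R).
Proof.
move=> cf; apply: (measurability _ (RGenCInfty.measurableE R)) => _ [_ [a ->] <-].
apply: measurable_separated => x nE.
have [sx|nsx] := pselect (unit_sphere R n x); last first.
  exists `|enorm x - 1|; first by rewrite normr_gt0 subr_eq0; apply/eqP.
  by move=> y [<- _]; exact: enorm_distl.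
have fxa : f x < a.
  by rewrite ltNge; apply/negP => afx; apply: nE; split=> //=; rewrite in_itv/= afx.
have [d d0 dP] := cf x sx (a - f x) ltac:(by rewrite subr_gt0).
exists d => // y [sy /=]; rewrite in_itv/= andbT => afy.
rewrite leNgt; apply/negP => /(dP _ sy); rewrite ltr_norml; lra.
Qed.

(** Bounded measurable functions on the sphere: a class stable under the
    operations below on which the mean is linear. *)
Definition tame f :=
  measurable_fun S (f : V -> R) /\
  exists M : R, forall xi, unit_sphere R n xi -> `|f xi| <= M.


Lemma tame_cst a : tame (fun=> a).
Proof. by split; [exact: measurable_cst|exists `|a|]. Qed.

Lemma tameD f g : tame f -> tame g -> tame (fun xi => f xi + g xi).
Proof.
move=> [mf [M fM]] [mg [N gN]]; split; first exact: measurable_funD.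
by exists (M + N) => xi sxi; rewrite (le_trans (ler_normD _ _))// lerD ?fM ?gN.
Qed.

Lemma tameM f g : tame f -> tame g -> tame (fun xi => f xi * g xi).
Proof.
move=> [mf [M fM]] [mg [N gN]]; split; first exact: measurable_funM.
by exists (M * N) => xi sxi; rewrite normrM ler_pM ?fM ?gN.
Qed.

Lemma tameZ a f : tame f -> tame (fun xi => a * f xi).
Proof. exact: tameM (tame_cst a). Qed.

Lemma tameB f g : tame f -> tame g -> tame (fun xi => f xi - g xi).
Proof.
move=> [mf [M fM]] [mg [N gN]]; split; first exact: measurable_funB.
by exists (M + N) => xi sxi; rewrite (le_trans (ler_normB _ _))// lerD ?fM ?gN.
Qed.

Lemma tame_norm f : tame f -> tame (fun xi => `|f xi|).
Proof.
move=> [mf [M fM]]; split; first by apply: measurableT_comp mf; exact: normr_measurable.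
by exists M => xi sxi; rewrite normr_id fM.
Qed.

Lemma tameX f k : tame f -> tame (fun xi => f xi ^+ k).
Proof.
move=> gf; elim: k => [|k IH]; first exact: tame_cst.
have -> : (fun xi => f xi ^+ k.+1) = (fun xi => f xi * f xi ^+ k).
  by apply/funext => xi; rewrite exprS.
exact: tameM.
Qed.

Lemma tame_sum (I : Type) (s : seq I) (F : I -> 'rV[R]_n -> R) :
  (forall i, tame (F i)) -> tame (fun xi => \sum_(i <- s) F i xi).
Proof.
move=> gF; elim: s => [|i s IH].
  by under [X in tame X]eq_fun do rewrite big_nil; exact: tame_cst.
by under [X in tame X]eq_fun do rewrite big_cons; exact: tameD.
Qed.

Lemma measurable_sphere_dist x : measurable_fun S ((fun xi => enorm (xi - x)) : V -> R).
Proof.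
apply: continuous_on_sphere_measurable => xi _ e e0; exists e => // eta _.
apply: le_lt_trans; apply: le_trans (enorm_distl _ _) _.
by rewrite opprB addrA subrK.
Qed.

Lemma tame_dist x : tame (fun xi => enorm (xi - x)).
Proof.
split; first exact: measurable_sphere_dist.
by exists (1 + enorm x) => xi /sphere_dist_le; rewrite ger0_norm// enorm_ge0.
Qed.

Lemma tame_inv_dist x : unit_ball R n x -> tame (fun xi => (enorm (xi - x))^-1).
Proof.
move=> x1; split.
  have -> : (fun xi => (enorm (xi - x))^-1) = (@powR R ^~ (-1)) \o (fun xi => enorm (xi - x)).
    by apply/funext => xi /=; rewrite powR_inv1// enorm_ge0.
  by apply: measurableT_comp (measurable_sphere_dist x); exact: measurable_powR.
exists (1 - enorm x)^-1 => xi sxi.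
rewrite normfV ger0_norm ?enorm_ge0// lef_pV2 ?posrE ?sphere_dist_ge ?sphere_dist_gt0//.
by rewrite subr_gt0.
Qed.

Lemma tame_poisson_kernel x : unit_ball R n x -> tame (poisson_kernel x).
Proof.
move=> x1; apply: tameX; apply: tameZ.
by under [X in tame X]eq_fun do rewrite -exprVn; apply: tameX; exact: tame_inv_dist.
Qed.

Hypothesis sphere_nondeg :
  fine (surface_outer_measure R n (unit_sphere R n)) != 0.

Lemma sphere_measureE (A : set V) :
  sigma A = (((fine (surface_outer_measure R n (unit_sphere R n)))^-1)%:E
            * surface_outer_measure R n A)%E.
Proof. by []. Qed.

(** A nonzero [fine] value means that the Hausdorff measure of the sphere is
    finite and nonzero, so that the normalization acts as intended. *)
Lemma sphere_measure1 : sigma S = 1%E.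
Proof.
rewrite sphere_measureE -[X in (_ * X)%E]fineK; last first.
  by move: sphere_nondeg; case: (surface_outer_measure R n S) => //=; rewrite eqxx.
by rewrite -EFinM mulVf.
Qed.

Lemma sphere_measure_lipschitz (L : R) (T : 'rV[R]_n -> 'rV[R]_n)
    (A B : set 'rV[R]_n) : 0 < L ->
  (forall x y, A x -> A y -> enorm (T x - T y) <= L * enorm (x - y)) ->
  B `<=` T @` A ->
  (sigma B <= (L ^+ n.-1)%:E * sigma A)%E.
Proof.
move=> L0 TL BTA; rewrite !sphere_measureE muleCA.
apply: lee_wpmul2l; first by rewrite lee_fin surface_scale_ge0.
apply: le_trans (hausdorff_lipschitz_image _ L0 TL).
exact: le_hausdorff.
Qed.

Lemma tame_integrable f : tame f -> sigma.-integrable S (EFin \o f).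
Proof.
move=> [mf [M fM]]; apply: measurable_bounded_integrable => //.
- exact: measurable_sphere.
- by rewrite sphere_measure1 ltry.
- exists M; split; first exact: num_real.
  by move=> N MN xi sxi /=; rewrite (le_trans (fM _ sxi))// ltW.
Qed.

Definition sphere_mean f : R := \int[sigma]_(xi in S) f xi.

Lemma sphere_mean_cst a : sphere_mean (fun=> a) = a.
Proof.
by rewrite /sphere_mean Rintegral_cst ?sphere_measure1 ?mulr1//; exact: measurable_sphere.
Qed.

Lemma sphere_meanD f g : tame f -> tame g ->
  sphere_mean (fun xi => f xi + g xi) = sphere_mean f + sphere_mean g.
Proof.
by move=> gf gg; apply: RintegralD; [exact: measurable_sphere|exact: tame_integrable..].
Qed.

Lemma sphere_meanB f g : tame f -> tame g ->
  sphere_mean (fun xi => f xi - g xi) = sphere_mean f - sphere_mean g.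
Proof.
by move=> gf gg; apply: RintegralB; [exact: measurable_sphere|exact: tame_integrable..].
Qed.

Lemma sphere_meanZ a f : tame f ->
  sphere_mean (fun xi => a * f xi) = a * sphere_mean f.
Proof.
by move=> gf; apply: RintegralZl; [exact: measurable_sphere|exact: tame_integrable].
Qed.

Lemma le_sphere_mean f g : tame f -> tame g ->
  (forall xi, unit_sphere R n xi -> f xi <= g xi) ->
  sphere_mean f <= sphere_mean g.
Proof.
move=> gf gg fg; apply: (@le_Rintegral _ V R sigma S f g _ _ _ fg).
- exact: measurable_sphere.
- exact: tame_integrable.
- exact: tame_integrable.
Qed.

Lemma eq_sphere_mean f g :
  (forall xi, unit_sphere R n xi -> f xi = g xi) -> sphere_mean f = sphere_mean g.
Proof. by move=> fg; apply: eq_Rintegral => xi; rewrite inE => /fg. Qed.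

Lemma le_norm_sphere_mean f : tame f ->
  `|sphere_mean f| <= sphere_mean (fun xi => `|f xi|).
Proof.
move=> gf; rewrite /sphere_mean; apply: le_normr_Rintegral.
  exact: measurable_sphere.
exact: tame_integrable.
Qed.

Lemma sphere_mean_sum (I : Type) (s : seq I) (F : I -> 'rV[R]_n -> R) :
  (forall i, tame (F i)) ->
  sphere_mean (fun xi => \sum_(i <- s) F i xi) = \sum_(i <- s) sphere_mean (F i).
Proof.
move=> gF; elim: s => [|i s IH].
  by under eq_sphere_mean do rewrite big_nil; rewrite big_nil sphere_mean_cst.
under eq_sphere_mean do rewrite big_cons.
by rewrite (sphere_meanD (gF i) (tame_sum s gF)) IH big_cons.
Qed.

Lemma EFin_sphere_mean f : tame f ->
  (sphere_mean f)%:E = (\int[sigma]_(xi in S) (f xi)%:E)%E.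
Proof.
move=> gf; rewrite /sphere_mean /Rintegral fineK//.
by apply: integrable_fin_num; [exact: measurable_sphere|exact: tame_integrable].
Qed.

End sphere_integral.

(** * The Poisson kernel as a Jacobian *)

Lemma le_integral_of_bounds d (T : measurableType d) (R : realType)
    (mu : {measure set T -> \bar R}) (A B : set T) (f g : T -> R) (M c k K : R) :
  measurable A -> measurable B -> measurable_fun A f -> measurable_fun B g ->
  (forall t, A t -> 0 <= f t <= M) -> (forall t, B t -> 0 <= g t /\ c <= g t) ->
  0 <= M -> 0 <= c -> 0 <= K -> (mu A <= k%:E * mu B)%E -> M * k <= K * c ->
  (\int[mu]_(t in A) (f t)%:E <= K%:E * \int[mu]_(t in B) (g t)%:E)%E.
Proof.
move=> mA mB mf mg fM cg M0 c0 K0 AB Mk.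
apply: (@le_trans _ _ (M%:E * mu A)%E).
  rewrite -integral_cst//; apply: ge0_le_integral => //.
  - by move=> t /fM; rewrite lee_fin => /andP[].
  - exact/measurable_EFinP.
  - by move=> t /fM; rewrite lee_fin => /andP[].
apply: (@le_trans _ _ (K%:E * (c%:E * mu B))%E); last first.
  apply: lee_wpmul2l; first by rewrite lee_fin.
  rewrite -integral_cst//; apply: ge0_le_integral => //.
  - exact/measurable_EFinP.
  - by move=> t /cg[_]; rewrite lee_fin.
apply: le_trans (lee_wpmul2l _ AB) _; first by rewrite lee_fin.
by rewrite !muleA -!EFinM; apply: lee_wpmul2r; rewrite ?measure_ge0 ?lee_fin.
Qed.

Lemma ge0_integral_level_split d (T : measurableType d) (R : realType)
    (mu : {measure set T -> \bar R}) (D : set T) (f g : T -> R) (a b c : R) :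
  measurable D -> measurable_fun D f -> measurable_fun D g ->
  (forall t, D t -> 0 <= g t) -> a <= b -> b <= c ->
  (\int[mu]_(t in [set t | D t /\ f t \in `[a, c[]) (g t)%:E =
   \int[mu]_(t in [set t | D t /\ f t \in `[a, b[]) (g t)%:E +
   \int[mu]_(t in [set t | D t /\ f t \in `[b, c[]) (g t)%:E)%E.
Proof.
move=> mD mf mg g0 ab bc.
have mI (i : interval R) : measurable [set t | D t /\ f t \in i].
  by have := mf mD [set` i] (measurable_itv i).
rewrite -ge0_integral_setU//.
- congr integral; apply/seteqP; split=> [t [Dt]|t [] [Dt]]; rewrite /= !in_itv/= => /andP[u v].
  + by have [fb|fb] := ltP (f t) b; [left|right]; rewrite ?u ?v ?fb.
  + by rewrite u (lt_le_trans v bc).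
  + by rewrite v (le_trans ab u).
- apply/measurable_EFinP; by apply: (measurable_funS mD _ mg) => t [] [].
- by move=> t [] [Dt _]; rewrite lee_fin g0.
- apply/disj_setPS => t [[_ /=]]; rewrite !in_itv/= => /andP[_ u] [_ /andP[v _]].
  by move: u; rewrite ltNge v.
Qed.

Lemma exists_lt_exprn (R : realType) (q M : R) : 1 < q -> exists N, M < q ^+ N.
Proof.
move=> q1; have qN N : N%:R * (q - 1) <= q ^+ N.
  elim: N => [|N IH]; first by rewrite mul0r expr0.
  have := exprn_ege1 N (ltW q1); rewrite exprS -natr1; move: IH q1.
  by move: (N%:R) (q ^+ N) => u v; nra.
exists (Num.bound (`|M| / (q - 1))); apply: lt_le_trans (qN _).
rewrite (le_lt_trans (ler_norm M))// -ltr_pdivrMr ?subr_gt0//.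
by rewrite archi_boundP// divr_ge0// subr_ge0 ltW.
Qed.

Lemma le_of_le_powM (R : realType) (k : nat) (I J : R) :
  (forall q : R, 1 < q -> I <= q ^+ k * J) -> I <= J.
Proof.
move=> H; have h : q ^+ k * J @[q --> (1 : R)^'+] --> 1 ^+ k * J.
  by apply: cvg_at_right_filter; apply: cvgMr_tmp; exact: exprn_continuous.
rewrite -[J]mul1r -(expr1n _ k); apply: (cvgr_to_ge h); near=> q; apply: H.
by near: q; exact: nbhs_right_gt.
Unshelve. all: by end_near. Qed.

Section poisson_mean.
Context {R : realType} {n : nat}.
Implicit Types (x xi eta : 'rV[R]_n) (f g : 'rV[R]_n -> R).

Local Notation V := (caratheodory_type (surface_outer_measure R n)).
Local Notation S := (unit_sphere R n : set V).
Local Notation sigma := (sphere_measure R n).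
Local Notation mean := (@sphere_mean R n).

Hypothesis sphere_nondeg :
  fine (surface_outer_measure R n (unit_sphere R n)) != 0.

Lemma measurable_tame_itv f (i : interval R) : tame f ->
  measurable ([set xi | unit_sphere R n xi /\ f xi \in i] : set V).
Proof.
move=> [mf _]; have := mf (measurable_sphere) [set` i] (measurable_itv i).
by [].
Qed.

Lemma tame_flip_dist x : unit_ball R n x ->
  tame (fun xi => (1 - enorm x ^+ 2) / enorm (xi - x)).
Proof. by move=> x1; apply: tameZ; exact: tame_inv_dist. Qed.

(** On a thin shell a <= |xi - x| < b of the sphere the kernel is constant up to
    powers of b / a, and the chord involution, Lipschitz with constant b^2 / D
    on the shell a <= D / |xi - x| < b, maps the latter onto the former.  The
    error factor tends to 1 with b / a, which makes the change of variables
    exact in the limit. *)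
Lemma shell_change_of_variables x (a b : R) (p : nat) :
  unit_ball R n x -> 0 < a -> a < b ->
  (\int[sigma]_(xi in [set xi | unit_sphere R n xi /\ enorm (xi - x)%R \in `[a, b[])
     (poisson_kernel x xi * enorm (xi - x) ^+ p)%:E
   <= ((b / a) ^+ (p + 2 * n.-1))%:E *
   \int[sigma]_(xi in [set xi | unit_sphere R n xi /\
       ((1 - enorm x ^+ 2) / enorm (xi - x))%R \in `[a, b[])
     (((1 - enorm x ^+ 2) / enorm (xi - x)) ^+ p)%:E)%E.
Proof.
move=> x1 a0 ab; have D0 := ball_defect_gt0 x1.
have b0 : 0 < b := lt_trans a0 ab.
set A : set V := [set xi | _ /\ enorm _ \in _]; set B : set V := [set xi | _ /\ _ / _ \in _].
set D := 1 - enorm x ^+ 2.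
have mA : measurable A by exact: measurable_tame_itv (tame_dist x).
have mB : measurable B by exact: measurable_tame_itv (tame_flip_dist x1).
set m := n.-1.
have ubA xi : A xi -> poisson_kernel x xi * enorm (xi - x) ^+ p
    <= (D / a ^+ 2) ^+ m * b ^+ p.
  move=> [sxi /itvP abxi]; rewrite ler_pM ?exprn_ge0 ?enorm_ge0//.
  - by rewrite divr_ge0 ?exprn_ge0 ?enorm_ge0// ltW.
  - rewrite lerXn2r ?nnegrE ?divr_ge0 ?exprn_ge0 ?enorm_ge0 ?(ltW a0) ?(ltW D0)//.
    rewrite ler_pM2l// lef_pV2 ?posrE ?exprn_gt0 ?sphere_dist_gt0//.
    by rewrite lerXn2r ?nnegrE ?enorm_ge0 ?(ltW a0) ?abxi.
  - by rewrite lerXn2r ?nnegrE ?enorm_ge0 ?(ltW b0)// ltW// abxi.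
have lbB xi : B xi -> a ^+ p <= (D / enorm (xi - x)) ^+ p.
  move=> [sxi /itvP abxi]; rewrite lerXn2r ?nnegrE ?(ltW a0) ?abxi//.
  by rewrite divr_ge0 ?enorm_ge0 ?(ltW D0).
have lip : (sigma A <= ((b ^+ 2 / D) ^+ m)%:E * sigma B)%E.
  apply: (@sphere_measure_lipschitz _ _ _ (chord_flip x)).
  - by rewrite divr_gt0 ?exprn_gt0.
  - move=> xi eta [sxi /itvP abxi] [seta /itvP abeta].
    rewrite chord_flip_conformal//; apply: ler_wpM2r; first exact: enorm_ge0.
    have r0 := sphere_dist_gt0 x1 sxi; have s0 := sphere_dist_gt0 x1 seta.
    rewrite -/D (_ : D / _ = (D / enorm (xi - x)) * (D / enorm (eta - x)) / D); last first.
      by field; rewrite !lt0r_neq0.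
    apply: ler_wpM2r; first by rewrite invr_ge0 ltW.
    by rewrite expr2 ler_pM ?divr_ge0 ?enorm_ge0 ?(ltW D0)// ltW ?abxi ?abeta.
  - by move=> xi [sxi abxi]; apply: chord_flip_image.
have gf : tame (fun xi => poisson_kernel x xi * enorm (xi - x) ^+ p).
  by apply: tameM; [exact: tame_poisson_kernel|apply: tameX; exact: tame_dist].
have gg : tame (fun xi => (D / enorm (xi - x)) ^+ p).
  by apply: tameX; exact: tame_flip_dist.
have AS : A `<=` S by move=> xi [].
have BS : B `<=` S by move=> xi [].
have mf := measurable_funS measurable_sphere AS gf.1.
have mg := measurable_funS measurable_sphere BS gg.1.
apply: (le_integral_of_bounds (M := (D / a ^+ 2) ^+ m * b ^+ p) (c := a ^+ p)
  mA mB mf mg _ _ _ _ _ lip) => //.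
- move=> xi Axi; rewrite ubA// andbT mulr_ge0 ?exprn_ge0 ?enorm_ge0//.
  by rewrite divr_ge0 ?exprn_ge0 ?enorm_ge0 ?(ltW D0).
- move=> xi Bxi; split; last exact: lbB.
  by rewrite exprn_ge0// divr_ge0 ?enorm_ge0 ?(ltW D0).
- by rewrite mulr_ge0 ?exprn_ge0// ?divr_ge0 ?exprn_ge0// ltW.
- by rewrite exprn_ge0// ltW.
- by rewrite exprn_ge0// divr_ge0// ltW.
rewrite exprD exprM !expr_div_n -!exprM !(mulnC 2%N) !exprM.
by rewrite le_eqVlt; apply/orP; left; apply/eqP; field; rewrite !expf_neq0// lt0r_neq0.
Qed.

Lemma tame_poisson_distX x p : unit_ball R n x ->
  tame (fun xi => poisson_kernel x xi * enorm (xi - x) ^+ p).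
Proof.
by move=> x1; apply: tameM; [exact: tame_poisson_kernel|apply: tameX; exact: tame_dist].
Qed.

Lemma poisson_kernel_ge0 x xi : unit_ball R n x -> 0 <= poisson_kernel x xi.
Proof.
by move=> x1; rewrite exprn_ge0// divr_ge0 ?exprn_ge0 ?enorm_ge0// ltW// ball_defect_gt0.
Qed.

Lemma shells_change_of_variables x (q : R) (p N : nat) :
  unit_ball R n x -> 1 < q ->
  (\int[sigma]_(xi in [set xi | unit_sphere R n xi /\
        enorm (xi - x)%R \in `[(1 - enorm x)%R, ((1 - enorm x) * q ^+ N)%R[])
     (poisson_kernel x xi * enorm (xi - x) ^+ p)%:E
   <= (q ^+ (p + 2 * n.-1))%:E *
   \int[sigma]_(xi in [set xi | unit_sphere R n xi /\
       ((1 - enorm x ^+ 2) / enorm (xi - x))%R \in `[(1 - enorm x)%R, ((1 - enorm x) * q ^+ N)%R[])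
     (((1 - enorm x ^+ 2) / enorm (xi - x)) ^+ p)%:E)%E.
Proof.
move=> x1 q1; have q0 : 0 < q by exact: lt_trans q1.
have c0 : 0 < 1 - enorm x by rewrite subr_gt0.
have D0 := ball_defect_gt0 x1.
elim: N => [|N IH].
  have E0 (h : 'rV[R]_n -> R) : [set xi | unit_sphere R n xi /\
      h xi \in `[(1 - enorm x)%R, ((1 - enorm x) * q ^+ 0)%R[] = set0.
    apply/seteqP; split=> // xi [_]; rewrite /= expr0 mulr1 in_itv/= => /andP[u].
    by rewrite ltNge u.
  by rewrite !E0 !integral_set0 mule0.
have gf := tame_poisson_distX p x1.
have gg : tame (fun xi => ((1 - enorm x ^+ 2) / enorm (xi - x)) ^+ p).
  by apply: tameX; exact: tame_flip_dist.
have qN : 1 - enorm x <= (1 - enorm x) * q ^+ N.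
  by rewrite ler_peMr ?exprn_ege1 ?(ltW q1) ?(ltW c0).
have qS : (1 - enorm x) * q ^+ N < (1 - enorm x) * q ^+ N.+1.
  by rewrite ltr_pM2l// exprS ltr_pMl ?exprn_gt0.
rewrite (ge0_integral_level_split sigma measurable_sphere (tame_dist x).1 gf.1 _ qN (ltW qS)); last first.
  by move=> xi _; rewrite mulr_ge0 ?poisson_kernel_ge0 ?exprn_ge0 ?enorm_ge0.
rewrite (ge0_integral_level_split sigma measurable_sphere (tame_flip_dist x1).1 gg.1 _ qN (ltW qS)); last first.
  by move=> xi _; rewrite exprn_ge0// divr_ge0 ?enorm_ge0 ?(ltW D0).
rewrite ge0_muleDr; last 2 first.
- by apply: integral_ge0 => xi _; rewrite lee_fin exprn_ge0// divr_ge0 ?enorm_ge0 ?(ltW D0).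
- by apply: integral_ge0 => xi _; rewrite lee_fin exprn_ge0// divr_ge0 ?enorm_ge0 ?(ltW D0).
apply: leeD; first exact: IH.
have aN : 0 < (1 - enorm x) * q ^+ N by rewrite mulr_gt0 ?exprn_gt0.
apply: le_trans (shell_change_of_variables p x1 aN qS) _.
rewrite [in X in (X%:E * _)%E]exprS mulrCA mulfK ?lt0r_neq0//.
Qed.

(** Both |xi - x| and D / |xi - x| lie between 1 - |x| and 1 + |x|, so finitely
    many shells of ratio q cover the sphere; then q decreases to 1. *)
Lemma poisson_change_of_variables x p : unit_ball R n x ->
  mean (fun xi => poisson_kernel x xi * enorm (xi - x) ^+ p)
   <= mean (fun xi => ((1 - enorm x ^+ 2) / enorm (xi - x)) ^+ p).
Proof.
move=> x1; have c0 : 0 < 1 - enorm x by rewrite subr_gt0.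
have D0 := ball_defect_gt0 x1.
have gf := tame_poisson_distX p x1.
have gg : tame (fun xi => ((1 - enorm x ^+ 2) / enorm (xi - x)) ^+ p).
  by apply: tameX; exact: tame_flip_dist.
apply: (@le_of_le_powM _ (p + 2 * n.-1)) => q q1.
have [N qN] : exists N, 2 / (1 - enorm x) < q ^+ N.
  exact: exists_lt_exprn.
rewrite -lee_fin EFinM (EFin_sphere_mean sphere_nondeg gf) (EFin_sphere_mean sphere_nondeg gg).
have := shells_change_of_variables p N x1 q1.
have full (h : 'rV[R]_n -> R) : (forall xi, unit_sphere R n xi -> 1 - enorm x <= h xi <= 1 + enorm x) ->
  [set xi | unit_sphere R n xi /\
      h xi \in `[(1 - enorm x)%R, ((1 - enorm x) * q ^+ N)%R[] = unit_sphere R n.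
  move=> hP; apply/seteqP; split=> [xi []//|xi sxi]; split=> //.
  have /andP[u v] := hP _ sxi; rewrite in_itv/= u (le_lt_trans v)//.
  rewrite mulrC -ltr_pdivrMr// (le_lt_trans _ qN)// ler_pM2r ?invr_gt0//.
  by rewrite lerD2l ltW.
rewrite !full// => xi sxi.
  have r0 := sphere_dist_gt0 x1 sxi.
  rewrite ler_pdivlMr// ler_pdivrMr//.
  rewrite (_ : 1 - enorm x ^+ 2 = (1 - enorm x) * (1 + enorm x)); last by ring.
  rewrite ler_pM2l// sphere_dist_le//= mulrC ler_pM2l ?sphere_dist_ge//.
  by rewrite ltr_wpDr ?enorm_ge0.
by rewrite sphere_dist_ge// sphere_dist_le.
Qed.

(** Applying [poisson_change_of_variables] with p = 0 bounds the mean by 1.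
    With p = 2m its two sides are D^m and D^m times the mean, since
    P_h |xi - x|^(2m) = D^m. *)
Lemma mean_poisson_kernel x : unit_ball R n x -> mean (poisson_kernel x) = 1.
Proof.
move=> x1; have D0 := ball_defect_gt0 x1; apply/eqP; rewrite eq_le; apply/andP; split.
  have := poisson_change_of_variables 0 x1.
  under eq_sphere_mean do rewrite expr0 mulr1.
  by under [X in _ <= X -> _]eq_sphere_mean do rewrite expr0; rewrite sphere_mean_cst.
have := poisson_change_of_variables (2 * n.-1) x1.
rewrite (@eq_sphere_mean _ _ _ (fun=> (1 - enorm x ^+ 2) ^+ n.-1)); last first.
  move=> xi sxi; have r0 := sphere_dist_gt0 x1 sxi.
  by rewrite /poisson_kernel exprM -exprMn divfK// sqrf_eq0 lt0r_neq0.
rewrite [X in _ <= X](@eq_sphere_mean _ _ _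
  (fun xi => (1 - enorm x ^+ 2) ^+ n.-1 * poisson_kernel x xi)); last first.
  move=> xi sxi; rewrite /poisson_kernel exprM -exprMn; congr (_ ^+ _).
  by rewrite expr_div_n expr2 mulrA.
rewrite sphere_mean_cst// sphere_meanZ//; last exact: tame_poisson_kernel.
by rewrite ler_pMr ?exprn_gt0.
Qed.

End poisson_mean.

(** * Two estimates on the Poisson kernel *)

Section poisson_bounds.
Context {R : realType} {n : nat}.
Implicit Types (x y xi eta : 'rV[R]_n) (f g h : 'rV[R]_n -> R).

Local Notation mean := (@sphere_mean R n).

Lemma exists_radial_projection x : (0 < n)%N ->
  exists2 zeta, unit_sphere R n zeta & x = enorm x *: zeta.
Proof.
move=> n0; have [->|x0] := eqVneq x 0; last first.
  exists ((enorm x)^-1 *: x).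
    by rewrite /unit_sphere/= enormZ ger0_norm ?invr_ge0 ?enorm_ge0// mulVf// gt_eqF// enorm_gt0.
  by rewrite scalerA divff ?scale1r// gt_eqF// enorm_gt0.
exists (delta_mx 0 (Ordinal n0)); last by rewrite enorm0 scale0r.
apply/eqP; rewrite -(eqrXn2 (n := 2))// ?enorm_ge0// sqr_enorm /dot.
rewrite (bigD1 (Ordinal n0))//= big1 => [|i i0]; last by rewrite !mxE (negbTE i0) andbF mulr0.
by rewrite !mxE !eqxx mulr1 addr0 expr1n.
Qed.

Lemma radial_projection_dist x zeta : unit_ball R n x -> unit_sphere R n zeta ->
  x = enorm x *: zeta -> enorm (x - zeta) = 1 - enorm x.
Proof.
move=> x1 sz xz; rewrite {1}xz -[X in _ - X]scale1r -scalerBl enormZ sz mulr1.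
by rewrite ler0_norm ?opprB// subr_le0 ltW.
Qed.

Lemma dyadic_point_ball zeta k : unit_sphere R n zeta ->
  unit_ball R n ((1 - 2^-1 ^+ k) *: zeta).
Proof.
have t0 : 0 < (2^-1 : R) ^+ k by rewrite exprn_gt0.
have t1 : (2^-1 : R) ^+ k <= 1 by rewrite exprn_ile1// invf_le1// ler1n.
by move=> sz; rewrite /unit_ball/= enormZ sz mulr1 ger0_norm; lra.
Qed.

Lemma sum_half_powers (K : nat) : \sum_(k < K) (2^-1 : R) ^+ k <= 2.
Proof.
suff -> : \sum_(k < K) (2^-1 : R) ^+ k = 2 - 2 * 2^-1 ^+ K.
  by rewrite gerBl mulr_ge0// exprn_ge0.
elim: K => [|K IH]; first by rewrite big_ord0 expr0 mulr1 subrr.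
by rewrite big_ord_recr/= IH exprS; field.
Qed.

Lemma exists_dyadic_scale (d M : R) (K : nat) : 2^-1 ^+ K <= d -> d <= M -> M <= 2 ->
  exists2 k : nat, (k <= K)%N & 2^-1 ^+ k <= M <= 2 * 2^-1 ^+ k.
Proof.
move=> Kd dM M2; have ex : exists k, (2^-1 : R) ^+ k <= M.
  by exists K; exact: le_trans dM.
case: (ex_minnP ex) => k kM kmin; exists k; first by apply: kmin; exact: le_trans dM.
rewrite kM /=; case: k kM kmin => [_ _|k kM kmin]; first by rewrite expr0 mulr1.
rewrite exprS mulrA divff// mul1r ltW// ltNge; apply/negP => /kmin.
by rewrite ltnn.
Qed.

(** Let M be the larger of |xi - zeta| and 1 - |x|; it is comparable to
    |xi - x|.  The term whose dyadic scale t is comparable to M suffices: the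
    point (1 - t) zeta is at distance at most 3t from xi, hence
    P_h((1 - t) zeta, xi) >= (t / (3t)^2)^m and t^(m-1) times it is at least
    9^(-m) / t. *)
Lemma inv_dist_le_poisson_sum x zeta xi (K : nat) : (2 <= n)%N ->
  unit_ball R n x -> unit_sphere R n zeta -> x = enorm x *: zeta ->
  unit_sphere R n xi -> 2^-1 ^+ K <= 1 - enorm x ->
  (enorm (xi - x))^-1 <= \sum_(k < K.+1) 2 * 9 ^+ n.-1 *
     ((2^-1 ^+ k) ^+ n.-2 * poisson_kernel ((1 - 2^-1 ^+ k) *: zeta) xi).
Proof.
move=> n2 x1 szeta xz sxi Kx.
have r0 := sphere_dist_gt0 x1 sxi.
(* the maximum guards against xi being much closer to zeta than x is *)
set M := Num.max (enorm (xi - zeta)) (1 - enorm x).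
have M2 : M <= 2.
  rewrite ge_max; apply/andP; split; last by have := enorm_ge0 x; lra.
  by rewrite (le_trans (enormD _ _))// enormN sxi szeta.
have dM : 1 - enorm x <= M by rewrite le_max lexx orbT.
have [k kK /andP[tM Mt]] := exists_dyadic_scale Kx dM M2.
have t0 : 0 < (2^-1 : R) ^+ k by rewrite exprn_gt0.
have t1 : (2^-1 : R) ^+ k <= 1 by rewrite exprn_ile1// invf_le1// ler1n.
have pos j := dyadic_point_ball j szeta.
rewrite (bigD1 (Ordinal (kK : (k < K.+1)%N)))//=.
apply: ler_wpDr.
  apply: sumr_ge0 => j _; apply: mulr_ge0; first by rewrite mulr_ge0 ?exprn_ge0.
  by apply: mulr_ge0; [rewrite !exprn_ge0|exact: poisson_kernel_ge0].
set t : R := 2^-1 ^+ k in t0 t1 tM Mt *.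
have Mr : M <= 2 * enorm (xi - x).
  rewrite ge_max; apply/andP; split.
    have xz' := radial_projection_dist x1 szeta xz.
    have := enorm_dist_triangle xi x zeta; have := sphere_dist_ge x sxi; lra.
  have := sphere_dist_ge x sxi; lra.
have ball_t : unit_ball R n ((1 - t) *: zeta) := pos k.
have s0 := sphere_dist_gt0 ball_t sxi.
have s3 : enorm (xi - (1 - t) *: zeta) <= 3 * t.
  have -> : xi - (1 - t) *: zeta = (xi - zeta) + t *: zeta.
    by rewrite scalerBl scale1r opprB addrA addrAC.
  rewrite (le_trans (enormD _ _))// enormZ szeta mulr1 ger0_norm ?(ltW t0)//.
  have : enorm (xi - zeta) <= M by rewrite le_max lexx.
  lra.
have Pt : (9 * t)^-1 ^+ n.-1 <= poisson_kernel ((1 - t) *: zeta) xi.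
  rewrite /poisson_kernel; apply: lerXn2r; rewrite ?nnegrE.
  - by rewrite invr_ge0 mulr_ge0// ltW.
  - by rewrite divr_ge0 ?exprn_ge0 ?enorm_ge0// ltW// ball_defect_gt0.
  rewrite enormZ szeta mulr1 ger0_norm ?subr_ge0// ler_pdivlMr ?exprn_gt0//.
  apply: (@le_trans _ _ ((9 * t)^-1 * (3 * t) ^+ 2)).
    rewrite ler_pM2l ?invr_gt0 ?mulr_gt0//.
    by rewrite lerXn2r ?nnegrE ?enorm_ge0 ?mulr_ge0 ?(ltW t0).
  have -> : (9 * t)^-1 * (3 * t) ^+ 2 = t by field; rewrite lt0r_neq0.
  have : t * t <= t * 1 by rewrite ler_pM2l.
  by rewrite sqrrB expr1n mul1r expr2; lra.
apply: (@le_trans _ _ (2 * 9 ^+ n.-1 * (t ^+ n.-2 * (9 * t)^-1 ^+ n.-1))); last first.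
  by rewrite ler_pM2l ?mulr_gt0 ?exprn_gt0// ler_pM2l ?exprn_gt0.
have -> : n.-1 = n.-2.+1 by case: (n) n2 => [|[]].
rewrite (_ : 2 * _ * _ = 2 / t); last first.
  rewrite exprVn exprMn !exprS.
  have : 0 < t ^+ n.-2 by rewrite exprn_gt0.
  have : 0 < (9 : R) ^+ n.-2 by rewrite exprn_gt0.
  move: (t ^+ _) (9 ^+ _) => u v u0 v0; field.
  by rewrite !lt0r_neq0.
rewrite -[X in X <= _]mul1r ler_pdivlMr// mulrAC ler_pdivrMr// mul1r.
by lra.
Qed.

Hypothesis sphere_nondeg :
  fine (surface_outer_measure R n (unit_sphere R n)) != 0.

(** The Poisson kernels of [inv_dist_le_poisson_sum] have mean 1, which leaves
    the sum of the t^(m-1); it is dominated by the sum of the dyadic t because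
    m - 1 >= 1. *)
Lemma mean_inv_dist_le x : (3 <= n)%N -> unit_ball R n x ->
  mean (fun xi => (enorm (xi - x))^-1) <= 4 * 9 ^+ n.-1.
Proof.
move=> n3 x1; have [zeta szeta xz] := exists_radial_projection x (ltnW (ltnW n3)).
have [K Kx] : exists K, (1 - enorm x)^-1 < 2 ^+ K by apply: exists_lt_exprn; rewrite ltr1n.
have {}Kx : (2^-1 : R) ^+ K <= 1 - enorm x.
  by rewrite exprVn invf_ple ?posrE ?exprn_gt0 ?subr_gt0// ltW.
have ballk k := dyadic_point_ball k szeta.
pose F (k : 'I_K.+1) xi := 2 * 9 ^+ n.-1 *
     ((2^-1 ^+ k) ^+ n.-2 * poisson_kernel ((1 - 2^-1 ^+ k) *: zeta) xi).
have gF k : tame (F k) by do 2 apply: tameZ; exact: tame_poisson_kernel.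
apply: le_trans (le_sphere_mean sphere_nondeg (tame_inv_dist x1) (tame_sum (index_enum 'I_K.+1) gF) _) _.
  by move=> xi sxi; apply: inv_dist_le_poisson_sum => //; exact: ltnW.
rewrite (sphere_mean_sum sphere_nondeg _ gF).
apply: (@le_trans _ _ (\sum_(k < K.+1) 2 * 9 ^+ n.-1 * 2^-1 ^+ k)); last first.
  rewrite -mulr_sumr (_ : 4 = 2 * 2); last by ring.
  rewrite -[leRHS]mulrA [leRHS]mulrCA [leLHS]mulrC.
  by rewrite ler_pM ?sum_half_powers ?mulr_ge0 ?exprn_ge0// sumr_ge0// => k _;
    rewrite exprn_ge0.
apply: ler_sum => k _.
have gP := tame_poisson_kernel (ballk k).
rewrite (sphere_meanZ sphere_nondeg _ (tameZ _ gP)) (sphere_meanZ sphere_nondeg _ gP).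
rewrite mean_poisson_kernel// mulr1 ler_pM2l ?mulr_gt0 ?exprn_gt0//.
(* here n >= 3 enters, as 1 <= n - 2 *)
rewrite -[leRHS]expr1; apply: ler_wiXn2l; last by case: (n) n3 => [|[|[]]].
  by rewrite exprn_ge0.
by rewrite exprn_ile1// invf_le1// ler1n.
Qed.

Lemma mean_poisson_dist_le x : (3 <= n)%N -> unit_ball R n x ->
  mean (fun xi => poisson_kernel x xi * enorm (xi - x)) <= 8 * 9 ^+ n.-1 * (1 - enorm x).
Proof.
move=> n3 x1; have D0 := ball_defect_gt0 x1.
have := poisson_change_of_variables sphere_nondeg 1 x1.
under eq_sphere_mean do rewrite expr1.
under [X in _ <= X -> _]eq_sphere_mean do rewrite expr1.
move=> /le_trans; apply; rewrite (sphere_meanZ sphere_nondeg _ (tame_inv_dist x1)).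
apply: (@le_trans _ _ ((1 - enorm x ^+ 2) * (4 * 9 ^+ n.-1))).
  by rewrite ler_pM2l// mean_inv_dist_le.
have x0 := enorm_ge0 x; have {}x1 : enorm x < 1 by [].
have : 0 < (9 : R) ^+ n.-1 by rewrite exprn_gt0.
move: (9 ^+ n.-1) => u u0; rewrite -subr_ge0.
rewrite (_ : _ - _ = 4 * u * (1 - enorm x) ^+ 2); last by ring.
by rewrite mulr_ge0 ?sqr_ge0// mulr_ge0// ltW.
Qed.

Lemma expr_diff_le (a b e : R) (m : nat) : 0 <= a -> 0 <= b -> b <= 3 * a ->
  `|a - b| <= e * a -> `|a ^+ m - b ^+ m| <= m%:R * 3 ^+ m * e * a ^+ m.
Proof.
move=> a0 b0 b3 abe; rewrite subrXX normrM.
have e0 : 0 <= e * a by exact: le_trans abe.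
case: m => [|m]; first by rewrite big_ord0 normr0 mulr0 !mul0r.
apply: (@le_trans _ _ (e * a * (m.+1%:R * (3 * a) ^+ m))).
  apply: ler_pM => //; apply: (le_trans (ler_norm_sum _ _ _)).
  rewrite mulr_natl -[m.+1 in leRHS]card_ord -sumr_const; apply: ler_sum => i _.
  rewrite ger0_norm ?mulr_ge0 ?exprn_ge0//.
  have -> : (3 * a) ^+ m = (3 * a) ^+ (m - i) * (3 * a) ^+ i.
    by rewrite -exprD subnK// -ltnS.
  have a3 : a <= 3 * a by lra.
  by apply: ler_pM; rewrite ?exprn_ge0//; apply: lerXn2r; rewrite ?nnegrE ?mulr_ge0.
rewrite exprMn !exprS.
have : 0 <= (3:R) ^+ m by rewrite exprn_ge0.
have : 0 <= a ^+ m by rewrite exprn_ge0.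
have : 0 <= m.+1%:R :> R by [].
move: (a ^+ m) (3 ^+ m) (m.+1%:R) => u v w u0 v0 w0.
have -> : w * (3 * v) * e * (a * u) = 3 * (e * a * (w * (v * u))) by ring.
have : 0 <= e * a * (w * (v * u)) by apply: (mulr_ge0 e0); rewrite !mulr_ge0.
by lra.
Qed.

(** The extreme values of E / s^2 are (1 +- 2k) / (1 -+ k)^2 times D / r^2, and
    for k <= 1/4 these factors lie between 1 - 7k and 1 + 7k. *)
Lemma quotient_sqr_perturbation (D E r s k : R) :
  0 < D -> 0 < r -> 0 < s -> 0 <= k -> k <= 4^-1 ->
  `|D - E| <= 2 * k * D -> `|r - s| <= k * r ->
  `|D / r ^+ 2 - E / s ^+ 2| <= 7 * k * (D / r ^+ 2).
Proof.
move=> D0 r0 s0 k0 k4; rewrite !ler_norml => /andP[E1 E2] /andP[s1 s2].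
have r2 : 0 < r ^+ 2 by rewrite exprn_gt0.
have s2' : 0 < s ^+ 2 by rewrite exprn_gt0.
have sl : (r * (1 - k)) ^+ 2 <= s ^+ 2.
  by rewrite lerXn2r ?nnegrE ?mulr_ge0 ?(ltW r0) ?(ltW s0)//; lra.
have su : s ^+ 2 <= (r * (1 + k)) ^+ 2.
  by rewrite lerXn2r ?nnegrE ?mulr_ge0 ?(ltW r0) ?(ltW s0)//; lra.
have ub : E / s ^+ 2 <= (1 + 7 * k) * (D / r ^+ 2).
  rewrite mulrA ler_pdivrMr// mulrAC ler_pdivlMr//.
  apply: (@le_trans _ _ ((1 + 2 * k) * D * r ^+ 2)); first by rewrite ler_pM2r//; lra.
  apply: (@le_trans _ _ ((1 + 7 * k) * D * (r * (1 - k)) ^+ 2)); last first.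
    by rewrite ler_wpM2l// mulr_ge0 ?(ltW D0)//; lra.
  rewrite [leRHS](_ : _ = (1 + 7 * k) * (1 - k) ^+ 2 * D * r ^+ 2); last by ring.
  rewrite ler_pM2r// ler_pM2r//.
  (* the two sides differ by this multiple of k *)
  have : 0 <= k * (3 - 13 * k + 7 * k ^+ 2).
    by rewrite mulr_ge0//; have := sqr_ge0 (k - 4^-1); rewrite sqrrB; lra.
  by rewrite -subr_ge0 [X in _ -> 0 <= X](_ : _ = k * (3 - 13 * k + 7 * k ^+ 2)); last by ring.
have lb : (1 - 7 * k) * (D / r ^+ 2) <= E / s ^+ 2.
  rewrite mulrA ler_pdivlMr// mulrAC ler_pdivrMr//.
  apply: (@le_trans _ _ ((1 - 2 * k) * D * r ^+ 2)); last by rewrite ler_pM2r//; lra.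
  have [k7|k7] := leP (1 - 7 * k) 0.
    apply: (@le_trans _ _ 0); last first.
      by rewrite !mulr_ge0 ?(ltW r2) ?(ltW D0)//; lra.
    by rewrite mulr_le0_ge0 ?(ltW s2')// mulr_le0_ge0 ?(ltW D0).
  apply: (@le_trans _ _ ((1 - 7 * k) * D * (r * (1 + k)) ^+ 2)).
    by rewrite ler_wpM2l// mulr_ge0 ?(ltW D0)//; lra.
  rewrite [leLHS](_ : _ = (1 - 7 * k) * (1 + k) ^+ 2 * D * r ^+ 2); last by ring.
  rewrite ler_pM2r// ler_pM2r//.
  have : 0 <= k * (3 + 13 * k + 7 * k ^+ 2).
    by rewrite mulr_ge0//; have := sqr_ge0 k; lra.
  by rewrite -subr_ge0 [X in _ -> 0 <= X](_ : _ = k * (3 + 13 * k + 7 * k ^+ 2)); last by ring.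
by apply/andP; split; lra.
Qed.

(** Moving x by k (1 - |x|) changes D by at most 2k D and |xi - x| by at most
    k |xi - x|, because 1 - |x| is at most D and at most |xi - x|. *)
Lemma poisson_kernel_diff_le x y xi : unit_ball R n x -> unit_sphere R n xi ->
  enorm (x - y) <= (1 - enorm x) / 4 ->
  `|poisson_kernel x xi - poisson_kernel y xi| <=
    n.-1%:R * 3 ^+ n.-1 * (7 * enorm (x - y) / (1 - enorm x)) * poisson_kernel x xi.
Proof.
move=> x1 sxi xy4.
have c0 : 0 < 1 - enorm x by rewrite subr_gt0.
have y1 : unit_ball R n y.
  by rewrite /unit_ball/=; have := enorm_distl x y; rewrite ler_norml; lra.
have D0 := ball_defect_gt0 x1; have E0 := ball_defect_gt0 y1.
have r0 := sphere_dist_gt0 x1 sxi; have s0 := sphere_dist_gt0 y1 sxi.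
have e0 := enorm_ge0 (x - y).
have xyn := enorm_distl x y.
have rs : `|enorm (xi - x) - enorm (xi - y)| <= enorm (x - y).
  rewrite (enormC x); apply: le_trans (enorm_distl _ _) _.
  by rewrite opprB addrC addrA subrK.
have rx := sphere_dist_ge x sxi.
have x0 := enorm_ge0 x; have y0 := enorm_ge0 y.
have D1 : 1 - enorm x <= 1 - enorm x ^+ 2 by nra.
have DE : `|(1 - enorm x ^+ 2) - (1 - enorm y ^+ 2)| <= 2 * enorm (x - y).
  rewrite (_ : _ - _ = - ((enorm x - enorm y) * (enorm x + enorm y))); last by ring.
  rewrite normrN normrM mulrC ler_pM//.
  by rewrite ger0_norm ?addr_ge0//; have : enorm x < 1 by []; have : enorm y < 1 by []; lra.
set a := (1 - enorm x ^+ 2) / enorm (xi - x) ^+ 2.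
set b := (1 - enorm y ^+ 2) / enorm (xi - y) ^+ 2.
have a0 : 0 <= a by rewrite divr_ge0 ?exprn_ge0 ?ltW.
have b0 : 0 <= b by rewrite divr_ge0 ?exprn_ge0 ?ltW.
have ab : `|a - b| <= 7 * enorm (x - y) / (1 - enorm x) * a.
  rewrite -[7 * _ / _]mulrA; apply: quotient_sqr_perturbation => //.
  - by rewrite divr_ge0// ltW.
  - by rewrite ler_pdivrMr// mulrC.
  - apply: (le_trans DE); rewrite -mulrA ler_pM2l// mulrAC ler_pdivlMr//.
    by rewrite ler_wpM2l.
  - apply: (le_trans rs); rewrite mulrAC ler_pdivlMr//.
    by rewrite ler_wpM2l.
apply: expr_diff_le => //.
have : 7 * enorm (x - y) / (1 - enorm x) <= 2.
  by rewrite ler_pdivrMr//; lra.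
move=> /(ler_wpM2r a0); move: ab; rewrite ler_norml => /andP[+ _].
by move: (7 * _ / _ * a) => Ka; rewrite -/a -/b; move: (a) (b) => a' b'; lra.
Qed.

End poisson_bounds.

(** * The local estimate for the Poisson integral *)

Section majorants.
Context {R : realType}.
Variable omega : R -> R.
Hypothesis omegaM : majorant omega.

Lemma majorant_small (e : R) : 0 < e ->
  exists2 d : R, 0 < d & forall t, 0 <= t -> t < d -> omega t < e.
Proof.
move=> e0; case: omegaM => /continuous_within_itvcyP[_ c0] w0 wm w00 _.
rewrite w00 in c0.
have /nbhs_right0P : \forall t \near (0 : R)^'+, `|omega t| < e.
  move/cvgr0Pnorm_lt : c0; exact.
case=> d /= d0 dP; exists d => // t; rewrite le_eqVlt => /predU1P[<-|t0 td].
  by rewrite w00.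
apply: le_lt_trans (ler_norm _) _; have := dP t; rewrite /= sub0r normrN gtr0_norm// add0r.
exact.
Qed.

Lemma majorant_ratio (s t : R) : 0 < s -> 0 <= t -> omega t <= (1 + t / s) * omega s.
Proof.
case: omegaM => _ w0 wm w00 wr s0 t0.
have ws := w0 _ (ltW s0).
have [ts|st] := leP t s.
  by apply: (le_trans (wm _ _ t0 ts)); rewrite ler_peMl// lerDl divr_ge0// ltW.
have tp := lt_trans s0 st.
have := wr _ _ s0 (ltW st); rewrite ler_pdivrMr// => /le_trans; apply.
by rewrite (_ : omega s / s * t = t / s * omega s) ?mulrDl ?mul1r ?lerDr//; ring.
Qed.

End majorants.

Section local_estimate.
Context {R : realType} {n : nat}.
Implicit Types (x y xi eta : 'rV[R]_n) (f g h : 'rV[R]_n -> R).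

Local Notation mean := (@sphere_mean R n).

Hypothesis sphere_nondeg :
  fine (surface_outer_measure R n (unit_sphere R n)) != 0.

(** Since both kernels have mean 1, h may be replaced by h - h zeta; the
    hypothesis on h is the growth that a modulus of continuity provides. *)
Lemma mean_poisson_diff_le h x y zeta (W : R) : (3 <= n)%N -> unit_ball R n x ->
  unit_sphere R n zeta -> tame h -> 0 <= W ->
  (forall xi, unit_sphere R n xi ->
     `|h xi - h zeta| <= W * (1 + 2 / (1 - enorm x) * enorm (xi - x))) ->
  enorm (x - y) <= (1 - enorm x) / 4 ->
  `|mean (fun xi => poisson_kernel x xi * h xi) - mean (fun xi => poisson_kernel y xi * h xi)|
   <= n.-1%:R * 3 ^+ n.-1 * (7 * enorm (x - y) / (1 - enorm x)) * (W * (1 + 16 * 9 ^+ n.-1)).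
Proof.
move=> n3 x1 szeta gh W0 hW xy.
have c0 : 0 < 1 - enorm x by rewrite subr_gt0.
have y1 : unit_ball R n y.
  by rewrite /unit_ball/=; have := enorm_distl x y; rewrite ler_norml; lra.
have gx := tame_poisson_kernel x1; have gy := tame_poisson_kernel y1.
have gd := tameB gx gy.
have gz : tame (fun xi => h xi - h zeta) := tameB gh (tame_cst (h zeta)).
set K := n.-1%:R * 3 ^+ n.-1 * (7 * enorm (x - y) / (1 - enorm x)).
have K0 : 0 <= K by rewrite /K !mulr_ge0 ?exprn_ge0 ?enorm_ge0// invr_ge0 ltW.
have <- : mean (fun xi => (poisson_kernel x xi - poisson_kernel y xi) * (h xi - h zeta))
    = mean (fun xi => poisson_kernel x xi * h xi) - mean (fun xi => poisson_kernel y xi * h xi).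
  rewrite (@eq_sphere_mean _ _ _ (fun xi => (poisson_kernel x xi * h xi - poisson_kernel y xi * h xi)
     - h zeta * (poisson_kernel x xi - poisson_kernel y xi))); last by move=> xi _; ring.
  rewrite (sphere_meanB sphere_nondeg (tameB (tameM gx gh) (tameM gy gh)) (tameZ _ gd)).
  rewrite (sphere_meanZ sphere_nondeg _ gd) (sphere_meanB sphere_nondeg gx gy).
  rewrite !mean_poisson_kernel// subrr mulr0 subr0.
  by rewrite (sphere_meanB sphere_nondeg (tameM gx gh) (tameM gy gh)).
have gr := tameM gx (tame_dist x).
have gR := tameZ (K * W) (tameD gx (tameZ (2 / (1 - enorm x)) gr)).
apply: le_trans (le_norm_sphere_mean sphere_nondeg (tameM gd gz)) _.
apply: le_trans (le_sphere_mean sphere_nondeg (tame_norm (tameM gd gz)) gR _) _.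
  move=> xi sxi; rewrite normrM.
  apply: (@le_trans _ _ ((K * poisson_kernel x xi) * (W * (1 + 2 / (1 - enorm x) * enorm (xi - x))))).
    by apply: ler_pM => //; [exact: poisson_kernel_diff_le|exact: hW].
  by rewrite le_eqVlt; apply/orP; left; apply/eqP; ring.
rewrite (sphere_meanZ sphere_nondeg _ (tameD gx (tameZ (2 / (1 - enorm x)) gr))).
rewrite (sphere_meanD sphere_nondeg gx (tameZ _ gr)) (sphere_meanZ sphere_nondeg _ gr).
rewrite mean_poisson_kernel// [leRHS]mulrA; apply: ler_wpM2l; first exact: mulr_ge0.
rewrite lerD2l.
apply: (@le_trans _ _ (2 / (1 - enorm x) * (8 * 9 ^+ n.-1 * (1 - enorm x)))).
  by rewrite ler_wpM2l ?mean_poisson_dist_le// divr_ge0// ltW.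
by rewrite le_eqVlt; apply/orP; left; apply/eqP; field; rewrite lt0r_neq0.
Qed.

Variables (omega : R -> R) (phi : 'rV[R]_n -> 'rV[R]_n).
Hypothesis omegaM : majorant omega.
Hypothesis phi_omega : forall xi eta, unit_sphere R n xi -> unit_sphere R n eta ->
  enorm (phi xi - phi eta) <= omega (enorm (xi - eta)).

Lemma coord_modulus xi eta i : unit_sphere R n xi -> unit_sphere R n eta ->
  `|phi xi 0 i - phi eta 0 i| <= omega (enorm (xi - eta)).
Proof.
move=> sxi seta; apply: le_trans (phi_omega sxi seta).
by have := le_coord_enorm (phi xi - phi eta) i; rewrite !mxE.
Qed.

Lemma tame_coord i : (0 < n)%N -> tame (fun xi => phi xi 0 i).
Proof.
move=> n0; split.
  apply: continuous_on_sphere_measurable => xi sxi e e0.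
  have [d d0 dP] := majorant_small omegaM e0; exists d => // eta seta xd.
  by apply: le_lt_trans (coord_modulus i sxi seta) _; rewrite dP// enorm_ge0.
have [zeta sz _] := exists_radial_projection (0 : 'rV[R]_n) n0.
exists (`|phi zeta 0 i| + omega 2) => xi sxi.
rewrite -[phi xi 0 i](subrK (phi zeta 0 i)) addrC.
apply: (le_trans (ler_normD _ _)); rewrite lerD2l.
apply: (le_trans (coord_modulus i sxi sz)).
case: omegaM => _ _ wm _ _; apply: wm; first exact: enorm_ge0.
by rewrite (le_trans (enormD _ _))// enormN sxi sz.
Qed.

Lemma poisson_integral_local_le x y : (3 <= n)%N -> unit_ball R n x ->
  enorm (x - y) <= (1 - enorm x) / 4 ->
  enorm (poisson_integral phi x - poisson_integral phi y) <=
    n%:R * (n.-1%:R * 3 ^+ n.-1 * 7 * (1 + 16 * 9 ^+ n.-1)) *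
    (omega (1 - enorm x) / (1 - enorm x)) * enorm (x - y).
Proof.
move=> n3 x1 xy; have n0 : (0 < n)%N := ltnW (ltnW n3).
have c0 : 0 < 1 - enorm x by rewrite subr_gt0.
have [zeta sz xz] := exists_radial_projection x n0.
have [_ w0 _ _ _] := omegaM.
rewrite -!mulrA; apply: enorm_le_bound => i; rewrite !mxE.
apply: le_trans (mean_poisson_diff_le n3 x1 sz (tame_coord i n0) (w0 _ (ltW c0)) _ xy) _.
  move=> xi sxi; apply: le_trans (coord_modulus i sxi sz) _.
  apply: le_trans (majorant_ratio omegaM c0 (enorm_ge0 _)) _.
  rewrite mulrC ler_wpM2l ?w0 ?(ltW c0)// lerD2l [leRHS]mulrAC ler_pM2r ?invr_gt0//.
  have xz' := radial_projection_dist x1 sz xz.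
  have := enorm_dist_triangle xi x zeta; have := sphere_dist_ge x sxi; lra.
by rewrite le_eqVlt; apply/orP; left; apply/eqP; ring.
Qed.

End local_estimate.

(** * Arc length *)

Section arclength.
Context {R : realType} {n : nat}.
Variable gamma : R -> 'rV[R]_n.

Lemma curve_length_ge0 (a b : R) : a <= b -> (0 <= curve_length a b gamma)%E.
Proof.
rewrite le_eqVlt => /predU1P[->|ab].
  apply: (@le_trans _ _ (curve_variation b b gamma [::])%:E).
    by rewrite lee_fin /curve_variation big_geq.
  by apply: ereal_sup_ubound; exists [::] => //; split => //=.
apply: (@le_trans _ _ (curve_variation a b gamma [:: b])%:E).
  by rewrite lee_fin; apply: sumr_ge0 => k _; exact: enorm_ge0.
by apply: ereal_sup_ubound; exists [:: b] => //; exact: itv_partition1.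
Qed.

Lemma curve_variation_rcons (a s t : R) (p : seq R) : itv_partition a s p ->
  curve_variation a t gamma (rcons p t) =
  curve_variation a s gamma p + enorm (gamma t - gamma s).
Proof.
move=> [_ /eqP lastp]; rewrite /curve_variation size_rcons big_nat_recr//=.
congr (_ + _).
  rewrite !big_nat; apply: eq_bigr => k /andP[_ kp].
  rewrite !nth_rcons kp -[a :: rcons p t]rcons_cons !nth_rcons/= ltnS (ltnW kp).
  rewrite (set_nth_default s)//; congr (enorm (_ - gamma _)).
  by rewrite (set_nth_default s)//= ltnS ltnW.
congr (enorm (gamma _ - gamma _)); first by rewrite nth_rcons ltnn eqxx.
by rewrite -rcons_cons nth_rcons/= ltnSn -lastp (last_nth t).
Qed.

Lemma curve_lengthD (a s t : R) : a <= s -> s < t ->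
  (curve_length a s gamma + (enorm (gamma t - gamma s))%:E <= curve_length a t gamma)%E.
Proof.
move=> as_ st; rewrite -leeBrDr//; apply: ge_ereal_sup => _ [p pp <-].
rewrite leeBrDr// -EFinD -curve_variation_rcons//.
apply: ereal_sup_ubound; exists (rcons p t) => //.
by rewrite -cats1; apply: itv_partition_cat pp _; exact: itv_partition1.
Qed.

Lemma within_continuous_enorm (a b : R) : {within `[a, b], continuous gamma} ->
  forall s, a <= s <= b -> forall e, 0 < e -> exists2 d, 0 < d &
    forall t, a <= t <= b -> `|s - t| < d -> enorm (gamma s - gamma t) < e.
Proof.
move=> /subspace_continuousP cg s sab e e0.
have e'0 : 0 < e / (n%:R + 1) by rewrite divr_gt0// ltr_wpDl.
have := cg s; rewrite /= in_itv/= => /(_ sab)/cvg_ballP/(_ _ e'0).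
case=> d /= d0 dP; exists d => // t tab st.
apply: (@le_lt_trans _ _ (n%:R * (e / (n%:R + 1)))).
  apply: enorm_le_bound => i; rewrite !mxE.
  have := dP t st; rewrite /= in_itv/= => /(_ tab)[_ /(_ 0 i)/ltW].
  exact.
by rewrite mulrA ltr_pdivrMr ?ltr_wpDl// mulrC ltr_pM2l// ltrDl.
Qed.

Hypothesis gamma_rect : rectifiable_curve gamma.
Local Notation len := (fun t => curve_length 0 t gamma).
Local Notation L := (fine (curve_length 0 1 gamma)).
Local Notation tau := (arclength_time gamma).

Let arcs u := [set t : R | 0 <= t <= 1 /\ (u%:E <= curve_length 0%R t gamma)%E].

Lemma curve_length_fineK : curve_length 0 1 gamma = L%:E.
Proof.
by rewrite fineK// ge0_fin_numE ?curve_length_ge0//; case: gamma_rect.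
Qed.

Lemma arcs1 u : u <= L -> arcs u 1.
Proof. by move=> uL; split; rewrite ?ler01 ?lexx// curve_length_fineK lee_fin. Qed.

Lemma arcs_has_inf u : u <= L -> has_inf (arcs u).
Proof. by move=> uL; split; [exists 1; exact: arcs1|exists 0 => t [/andP[]]]. Qed.

Lemma arclength_time_bounds u : u <= L -> 0 <= tau u <= 1.
Proof.
move=> uL; have [ne lb] := arcs_has_inf uL; apply/andP; split.
  by apply: lb_le_inf => // t [/andP[]].
by apply: ge_inf => //; exact: arcs1.
Qed.

Lemma lt_arclength_time u t : u <= L -> 0 <= t -> t < tau u -> (len t < u%:E)%E.
Proof.
move=> uL t0 tu; rewrite ltNge; apply/negP => ut.
have /andP[_ tau1] := arclength_time_bounds uL.
suff : tau u <= t by rewrite leNgt tu.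
by apply: ge_inf; [exact: (arcs_has_inf uL).2|split=> //; rewrite t0 ltW// (lt_le_trans tu)].
Qed.

Lemma arclength_time_adherent u e : u <= L -> 0 < e ->
  exists2 t, arcs u t & tau u <= t < tau u + e.
Proof.
move=> uL e0; have [t ut te] := inf_adherent e0 (arcs_has_inf uL).
by exists t => //; rewrite te andbT; apply: ge_inf => //; exact: (arcs_has_inf uL).2.
Qed.

Lemma arclength_time_le u v : u <= v -> v <= L -> tau u <= tau v.
Proof.
move=> uv vL; apply: lb_le_inf; first exact: (arcs_has_inf vL).1.
move=> t [t01 vt]; apply: ge_inf; first exact: (arcs_has_inf (le_trans uv vL)).2.
by split=> //; apply: le_trans vt; rewrite lee_fin.
Qed.

Lemma arclength_param0 : 0 <= L -> gamma (tau 0) = gamma 0.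
Proof.
move=> L0; congr gamma; apply/eqP; rewrite eq_le; apply/andP; split; last first.
  by have /andP[] := arclength_time_bounds L0.
apply: ge_inf; first exact: (arcs_has_inf L0).2.
by split; rewrite ?lexx ?ler01// curve_length_ge0.
Qed.

(** The curve may stop moving before time 1, but then it stays at its end
    point. *)
Lemma arclength_paramL : gamma (tau L) = gamma 1.
Proof.
apply/eqP; rewrite -subr_eq0; apply/eqP; apply: enorm0_eq0.
apply/eqP; rewrite eq_le enorm_ge0 andbT; apply/ler_addgt0Pr => e e0.
rewrite add0r; case: (gamma_rect) => cg _.
have tL := arclength_time_bounds (lexx L).
have [d d0 dP] := within_continuous_enorm cg tL e0.
have [t [t01 Lt] /andP[tt td]] := arclength_time_adherent (lexx L) d0.
have -> : gamma 1 = gamma t.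
  have /andP[t0] := t01; rewrite le_eqVlt => /predU1P[->//|t1].
  apply/eqP; rewrite -subr_eq0; apply/eqP; apply: enorm0_eq0.
  apply/eqP; rewrite eq_le enorm_ge0 andbT -lee_fin.
  have := curve_lengthD t0 t1; rewrite curve_length_fineK => /(le_trans (leeD2r _ Lt)).
  by rewrite -EFinD !lee_fin gerDl.
by apply/ltW/dP => //; rewrite distrC ger0_norm ?subr_ge0//; lra.
Qed.

(** Times t slightly after tau u and s slightly before tau v satisfy
    u <= len t and len s < v by definition of tau, so the chord from t to s has
    length at most v - u; continuity of the curve moves t and s to tau u and
    tau v. *)
Lemma arclength_param_lipschitz u v : 0 <= u -> u <= v -> v <= L ->
  enorm (gamma (tau v) - gamma (tau u)) <= v - u.
Proof.
move=> u0 uv vL; have uL := le_trans uv vL.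
have tu := arclength_time_bounds uL; have tv := arclength_time_bounds vL.
have := arclength_time_le uv vL; rewrite le_eqVlt => /predU1P[->|tuv].
  by rewrite subrr enorm0 subr_ge0.
apply/ler_addgt0Pr => e e0; have e2 : 0 < e / 2 by rewrite divr_gt0.
case: (gamma_rect) => cg _.
have [d1 d10 d1P] := within_continuous_enorm cg tu e2.
have [d2 d20 d2P] := within_continuous_enorm cg tv e2.
set mid := (tau u + tau v) / 2.
have [um mv] : tau u < mid /\ mid < tau v by rewrite /mid; split; lra.
have r0 : 0 < Num.min d1 (mid - tau u) by rewrite lt_min d10 subr_gt0.
have [t [t01 ut] /andP[tut]] := arclength_time_adherent uL r0.
rewrite -ltrBlDl lt_min => /andP[td1 tmid].
pose s := Num.max mid (tau v - d2 / 2).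
have ms : mid <= s by rewrite le_max lexx.
have ds : tau v - d2 / 2 <= s by rewrite le_max lexx orbT.
have sv : s < tau v by rewrite gt_max mv; lra.
have /andP[tu0 tu1] := tu; have /andP[tv0 tv1] := tv; have /andP[t0 t1] := t01.
have s01 : 0 <= s <= 1 by lra.
have ts : t < s by lra.
have A1 : enorm (gamma (tau u) - gamma t) < e / 2.
  by apply: d1P => //; rewrite distrC ger0_norm; lra.
have A2 : enorm (gamma (tau v) - gamma s) < e / 2.
  by apply: d2P => //; rewrite ger0_norm; lra.
have A3 : enorm (gamma s - gamma t) <= v - u.
  have /andP[s0 _] := s01.
  have := curve_lengthD t0 ts; move/(le_trans (leeD2r _ ut)).
  move=> /le_lt_trans/(_ (lt_arclength_time vL s0 sv)).
  by rewrite -EFinD lte_fin; lra.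
rewrite (enormC (gamma (tau u))) in A1.
have := enorm_dist_triangle (gamma (tau v)) (gamma s) (gamma (tau u)).
have := enorm_dist_triangle (gamma s) (gamma t) (gamma (tau u)).
lra.
Qed.

End arclength.

(** * Integration along the curve *)

(** A mean value inequality that uses increments over short steps in place of
    a derivative.  In the hypothesis w ranges over the whole step, so that each
    increment is a lower bound for the integral of g over the step. *)
Lemma increment_le_integral (R : realType) (n : nat) (f : R -> 'rV[R]_n) (g : R -> R)
    (L delta : R) :
  0 <= L -> 0 < delta -> measurable_fun `[0, L] g ->
  (forall u, 0 <= u <= L -> 0 <= g u) ->
  (forall u v w, 0 <= u -> u <= w -> w <= v -> v <= L -> v - u <= delta ->
     enorm (f v - f u) <= (v - u) * g w) ->
  ((enorm (f L - f 0))%:E <= \int[lebesgue_measure]_(u in `[0%R, L]) (g u)%:E)%E.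
Proof.
move=> L0 d0 mg g0 fg.
have main (a : R) k : 0 < a -> a <= delta -> k%:R * a <= L ->
  ((enorm (f (k%:R * a) - f 0))%:E
     <= \int[lebesgue_measure]_(u in `[0%R, (k%:R * a)%R]) (g u)%:E)%E.
  move=> a0 ad; elim: k => [|k IH] kL.
    rewrite mul0r subrr enorm0; apply: integral_ge0 => u.
    by rewrite /= in_itv/= => /andP[u0 u1]; rewrite lee_fin g0// u0 (le_trans u1).
  have kk : k%:R * a <= k.+1%:R * a by rewrite ler_pM2r// ler_nat.
  have k0 : 0 <= k%:R * a by rewrite mulr_ge0// ltW.
  have ka : k.+1%:R * a - k%:R * a = a by rewrite -mulrBl -natrB// subSnn mul1r.
  have -> : `[0%R, k.+1%:R * a]%classic = `[0%R, k%:R * a]%classic `|` `]k%:R * a, k.+1%:R * a]%classic.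
    apply/seteqP; split=> u; rewrite /= !in_itv/=.
      by move=> /andP[-> ->]; rewrite andbT; case: leP => h; [left|right].
    by move=> [/andP[-> /le_trans->]|/andP[/(le_lt_trans k0)/ltW-> ->]].
  rewrite ge0_integral_setU//; last 3 first.
  - apply/measurable_EFinP; apply: (measurable_funS _ _ mg) => // u [] /=; rewrite !in_itv/=.
      by move=> /andP[-> u1]; rewrite (le_trans u1)// (le_trans kk).
    by move=> /andP[u0 u1]; rewrite (le_trans u1)// (ltW (le_lt_trans k0 u0)).
  - move=> u [] /=; rewrite !in_itv/= lee_fin => /andP[u0 u1]; apply: g0.
      by rewrite u0 (le_trans u1)// (le_trans kk).
    by rewrite (le_trans u1)// (ltW (le_lt_trans k0 u0)).
  - by apply/disj_setPS => u [/=]; rewrite !in_itv/= => /andP[_ u1] /andP[]; rewrite ltNge u1.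
  apply: (@le_trans _ _ ((enorm (f (k%:R * a) - f 0))%:E
      + (enorm (f (k.+1%:R * a) - f (k%:R * a)))%:E)%E).
    by rewrite -EFinD lee_fin [leRHS]addrC; exact: enorm_dist_triangle.
  apply: leeD; first by apply: IH; exact: le_trans kL.
  set c := enorm _.
  have -> : c%:E = (\int[lebesgue_measure]_(u in `](k%:R * a)%R, (k.+1%:R * a)%R]) (cst (c / a)%:E) u)%E.
    rewrite integral_cst//= lebesgue_measure_itv/= lte_fin -subr_gt0 ka a0.
    by rewrite -EFinB ka -EFinM divfK// gt_eqF.
  apply: ge0_le_integral => //.
  - by move=> u _; rewrite lee_fin divr_ge0 ?enorm_ge0// ltW.
  - apply/measurable_EFinP; apply: (measurable_funS _ _ mg) => // u; rewrite /= !in_itv/=.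
    by move=> /andP[u0 u1]; rewrite (le_trans u1)// (ltW (le_lt_trans k0 u0)).
  - move=> u; rewrite /= in_itv/= => /andP[u0 u1]; rewrite lee_fin ler_pdivrMr//.
    by rewrite mulrC -[X in _ <= X * _]ka; apply: fg; rewrite ?ka// ltW.
have [->|Ln0] := eqVneq L 0.
  rewrite subrr enorm0; apply: integral_ge0 => u.
  rewrite /= in_itv/= => /andP[u0 u1]; rewrite lee_fin g0// u0 (le_trans u1)//.
have Lp : 0 < L by rewrite lt_neqAle eq_sym Ln0.
pose N := (Num.bound (L / delta)).+1.
have Np : 0 < N%:R :> R by rewrite ltr0n.
have NL : N%:R * (L / N%:R) = L by rewrite mulrC divfK// gt_eqF.
rewrite -[X in f X]NL -[X in `[_, X]]NL.
apply: main; rewrite ?NL// ?divr_gt0//.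
rewrite ler_pdivrMr// -ler_pdivrMl// mulrC.
apply: (le_trans (ltW (archi_boundP _))); first by rewrite divr_ge0 ?ltW.
by rewrite ler_nat.
Qed.

Lemma poisson_integral_degenerate (R : realType) (n : nat) (phi : 'rV[R]_n -> 'rV[R]_n) x :
  fine (surface_outer_measure R n (unit_sphere R n)) = 0 ->
  poisson_integral phi x = 0.
Proof.
move=> S0; apply/rowP => i; rewrite !mxE /Rintegral.
rewrite (@eq_measure_integral _ _ _ _ mzero).
  by rewrite integral_measure_zero.
by move=> A mA AS; rewrite sphere_measureE S0 invr0 mul0e.
Qed.

Lemma lipschitz_within_continuous (R : realType) (f : R -> R) (a b K : R) :
  (forall u v, a <= u -> u <= v -> v <= b -> `|f v - f u| <= K * (v - u)) ->
  {within `[a, b], continuous f}.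
Proof.
move=> fK; apply/subspace_continuousP => u; rewrite /= in_itv/= => /andP[au ub].
have K1 : 0 < `|K| + 1 by rewrite ltr_wpDl.
apply/cvgrPdist_lt => e e0; exists (e / (`|K| + 1)); first by rewrite /= divr_gt0.
move=> v /= uv; rewrite in_itv/= => /andP[av vb].
have fK' : `|f u - f v| <= K * `|u - v|.
  have [uv'|/ltW vu'] := leP u v.
    by rewrite distrC (distrC u) (ger0_norm (x := v - u)) ?subr_ge0// fK.
  by rewrite (ger0_norm (x := u - v)) ?subr_ge0// fK.
apply: (le_lt_trans fK').
apply: (@le_lt_trans _ _ ((`|K| + 1) * `|u - v|)).
  by rewrite ler_wpM2r// (le_trans (ler_norm K))// lerDl.
by rewrite mulrC -ltr_pdivlMr.
Qed.

(** Allows the value of omega (s) / s at the beginning of a step to be replaced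
    by its value anywhere on the step. *)
Lemma majorant_ratio_perturbation (R : realType) (omega : R -> R) (s t : R) :
  majorant omega -> 0 < s -> 0 < t -> t <= (5 / 4) * s ->
  omega s / s <= (5 / 4) * (omega t / t).
Proof.
move=> [_ w0 wm _ wr] s0 t0 ts.
have ht : 0 <= omega t / t by rewrite divr_ge0 ?w0 ?ltW.
have [ts'|/ltW st] := leP t s.
  by have := wr _ _ t0 ts'; lra.
rewrite ler_pdivrMr//; apply: le_trans (wm _ _ (ltW s0) st) _.
rewrite -[leLHS](divfK (lt0r_neq0 t0)).
by rewrite (_ : 5 / 4 * _ * s = omega t / t * (5 / 4 * s)) ?ler_wpM2l//; ring.
Qed.

Section line_integral.
Context {R : realType} {n : nat}.
Variables (omega : R -> R) (gamma : R -> 'rV[R]_n).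
Hypothesis omegaM : majorant omega.
Hypothesis gamma_rect : rectifiable_curve gamma.
Hypothesis gamma_ball : forall t : R, 0 <= t <= 1 -> unit_ball R n (gamma t).

Local Notation L := (fine (curve_length 0 1 gamma)).
Local Notation c u := (gamma (arclength_time gamma u)).
Local Notation depth u := (1 - enorm (c u)).
Local Notation density u := (omega (depth u) / depth u).

Lemma depth_gt0 u : u <= L -> 0 < depth u.
Proof.
by move=> uL; rewrite subr_gt0; apply: gamma_ball; exact: arclength_time_bounds.
Qed.

Lemma depth_lipschitz u v : 0 <= u -> u <= v -> v <= L ->
  `|depth v - depth u| <= 1 * (v - u).
Proof.
move=> u0 uv vL; rewrite mul1r.
rewrite (_ : _ - _ = enorm (c u) - enorm (c v)); last by ring.
apply: (le_trans (enorm_distl _ _)); rewrite enormC.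
exact: arclength_param_lipschitz.
Qed.

Lemma depth_within_continuous : {within `[0, L], continuous (fun u => depth u)}.
Proof. by apply: (lipschitz_within_continuous (K := 1)); exact: depth_lipschitz. Qed.

Lemma density_measurable : measurable_fun `[0, L] (fun u => density u).
Proof.
have mdepth : measurable_fun `[0, L] (fun u => depth u).
  apply: subspace_continuous_measurable_fun; first exact: measurable_itv.
  exact: depth_within_continuous.
apply: measurable_funM.
  have : measurable_fun `[0, L] (omega \o (fun u => depth u)); last by [].
  apply: (measurable_comp (F := (`[0%R, +oo[%classic : set R)) _ _ _ mdepth).
    exact: measurable_itv.
    move=> _ [u /= + <-]; rewrite in_itv/= => /andP[_ /depth_gt0/ltW u0].
    by rewrite in_itv/= u0.
  apply: subspace_continuous_measurable_fun; first exact: measurable_itv.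
  by case: omegaM.
apply: (eq_measurable_fun (fun u => depth u `^ (-1))).
  move=> u; rewrite inE /= in_itv/= => /andP[_ /depth_gt0/ltW u0].
  by rewrite powR_inv1.
have : measurable_fun `[0, L] ((@powR R ^~ (-1)) \o (fun u => depth u)); last by [].
by apply: measurableT_comp mdepth; exact: measurable_powR.
Qed.

Lemma curve_length_fine_ge0 : 0 <= L.
Proof. by rewrite fine_ge0// curve_length_ge0. Qed.

(** A curve in the open ball stays away from the sphere, which provides one
    step length small enough for the local bound along all of the curve. *)
Lemma depth_lower_bound : exists2 d : R, 0 < d & forall u, 0 <= u <= L -> d <= depth u.
Proof.
have [u0 u0L umin] := EVT_min curve_length_fine_ge0 depth_within_continuous.
exists (depth u0).
  by move: u0L; rewrite in_itv/= => /andP[_]; exact: depth_gt0.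
by move=> u uL; apply: umin; rewrite in_itv.
Qed.

Lemma increment_le_line_integral (F : 'rV[R]_n -> 'rV[R]_n) (alpha : R) : 0 <= alpha ->
  (forall x y, unit_ball R n x -> enorm (x - y) <= (1 - enorm x) / 4 ->
     enorm (F x - F y) <= alpha * (omega (1 - enorm x) / (1 - enorm x)) * enorm (x - y)) ->
  ((enorm (F (gamma 0) - F (gamma 1)))%:E <=
     (5 / 4 * alpha)%:E * line_integral gamma (fun eta => omega (1 - enorm eta) / (1 - enorm eta))%R)%E.
Proof.
move=> a0 Floc; have L0 := curve_length_fine_ge0.
have [d d0 dP] := depth_lower_bound.
have [_ w0 _ _ _] := omegaM.
have dens0 u : 0 <= u <= L -> 0 <= density u.
  by move=> /andP[_ /depth_gt0 u0]; rewrite divr_ge0 ?w0 ?ltW.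
have k0 : 0 <= 5 / 4 * alpha by rewrite mulr_ge0.
have densE0 u : `[0%R, L]%classic u -> (0 <= (density u)%:E)%E.
  by rewrite /= in_itv/= lee_fin; exact: dens0.
have mdens : measurable_fun `[0%R, L]%classic (fun u => (density u)%:E).
  by apply/measurable_EFinP; exact: density_measurable.
have scale := ge0_integralZl_EFin lebesgue_measure (measurable_itv _) densE0 mdens k0.
apply: (@le_trans _ _ (\int[lebesgue_measure]_(u in `[0%R, L]) (5 / 4 * alpha * density u)%:E)%E); last first.
  by rewrite le_eqVlt; apply/orP; left; apply/eqP; exact: scale.
rewrite -(arclength_param0 gamma_rect)// -(arclength_paramL gamma_rect) enormC.
have d4 : 0 < d / 4 by rewrite divr_gt0.
apply: (@increment_le_integral _ _ (fun u => F (c u)) (fun u => 5 / 4 * alpha * density u) _ _ L0 d4).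
- by apply: measurable_funM; [exact: measurable_cst|exact: density_measurable].
- by move=> u uL; rewrite mulr_ge0// dens0.
move=> u v w u0 uw wv vL uv4.
have uv := le_trans uw wv; have uL := le_trans uv vL; have wL := le_trans wv vL.
have w0' := le_trans u0 uw.
have cuv : enorm (c u - c v) <= v - u by rewrite enormC arclength_param_lipschitz.
have du : d <= depth u by rewrite dP ?u0.
rewrite enormC; apply: le_trans (Floc _ _ _ _) _.
- by apply: gamma_ball; exact: arclength_time_bounds.
- by lra.
rewrite [leRHS]mulrC; apply: ler_pM => //.
- by rewrite mulr_ge0// dens0 ?u0.
- exact: enorm_ge0.
rewrite [5 / 4 * _]mulrC -[leRHS]mulrA ler_wpM2l//.
apply: majorant_ratio_perturbation => //; try exact: depth_gt0.
have := depth_lipschitz u0 uw wL; rewrite ler_norml => /andP[_]; lra.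
Qed.

End line_integral.

Unset Implicit Arguments.

Theorem theorem1p3 (R : realType) (n : nat) (hn : (3 <= n)%N) :
  exists alpha0 : R,
    forall (omega : R -> R) (phi : 'rV[R]_n -> 'rV[R]_n) (C : R),
      fast_majorant omega ->
      (forall xi eta, unit_sphere R n xi -> unit_sphere R n eta ->
         enorm (phi xi - phi eta) <= omega (enorm (xi - eta))) ->
      0 < C ->
      ball_extension_constant R n omega C ->
      forall x y, unit_ball R n x -> unit_ball R n y ->
        enorm (poisson_integral phi x - poisson_integral phi y)
          <= C * alpha0 * omega (enorm (x - y)).
Proof.
pose alpha : R := n%:R * (n.-1%:R * 3 ^+ n.-1 * 7 * (1 + 16 * 9 ^+ n.-1)).
have alpha_ge0 : 0 <= alpha by rewrite /alpha !mulr_ge0 ?addr_ge0 ?mulr_ge0 ?exprn_ge0.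
exists (5 / 4 * alpha) => omega phi C [omegaM _] phi_omega C0 ext x y x1 y1.
have [_ w0 _ _ _] := omegaM.
have [S0|S0] := eqVneq (fine (surface_outer_measure R n (unit_sphere R n))) 0.
  rewrite !poisson_integral_degenerate// subrr enorm0.
  by apply: mulr_ge0; [rewrite !mulr_ge0// ltW|exact/w0/enorm_ge0].
have [gamma [gamma_rect g0 g1 gamma_ball len_le]] := ext x y x1 y1.
rewrite -lee_fin -{1}g0 -{1}g1.
apply: le_trans (increment_le_line_integral omegaM gamma_rect gamma_ball alpha_ge0 _) _.
  by move=> u v u1 uv; apply: (poisson_integral_local_le S0 omegaM phi_omega).
have k0 : 0 <= 5 / 4 * alpha by rewrite mulr_ge0.
apply: le_trans (lee_wpmul2l _ len_le) _; first by rewrite lee_fin.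
by rewrite -EFinM lee_fin mulrA [_ * C]mulrC.
Qed.
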